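(* Suppose that $f_\theta(\omega)=\sigma^2|\phi_p(\omega)|^{-2}$ where $\phi_p(\omega)=1-\sum_{u=1}^{p}\phi_ue^{-iu\omega}$ (the roots of the corresponding characteristic polynomial $1-\sum_{u=1}^p\phi_uz^u$ lie outside the unit circle) and $p\le n$. The predictive DFT has the analytic form $$\widehat{J}_n(\omega;f_\theta)=\frac{n^{-1/2}}{\phi_p(\omega)}\sum_{\ell=1}^{p}X_\ell\sum_{s=0}^{p-\ell}\phi_{\ell+s}e^{-is\omega}+e^{in\omega}\frac{n^{-1/2}}{\overline{\phi_p(\omega)}}\sum_{\ell=1}^{p}X_{n+1-\ell}\sum_{s=0}^{p-\ell}\phi_{\ell+s}e^{i(s+1)\omega}.$$ If $p\le n/2$, then $D_n(f_\theta)$ is a rank $2p$ matrix whose entries are, for $1\le k\le n$, $$D_n(f_\theta)_{k,t}=n^{-1/2}\begin{cases}\phi_{t,p}(\omega_{k,n}) & 1\le t\le p\\ 0 & p+1\le t\le n-p\\ e^{i\omega_{k,n}}\overline{\phi_{n+1-t,p}(\omega_{k,n})} & n-p+1\le t\le n,\end{cases}$$ where $\phi_{j,p}(\omega)=\phi_p(\omega)^{-1}\sum_{s=0}^{p-j}\phi_{j+s}e^{-is\omega}$. (If $n/2<p\le n$, then the entries of $D_n(f_\theta)$ coming from the first $p$ columns and from the last $p$ columns overlap.) Let $\widetilde{\phi}_0=1$, $\widetilde{\phi}_s=-\phi_s$ for $1\le s\le p$, and $\widetilde{\phi}_s=0$ otherwise. If $1\le p\le n/2$, then for $1\le s,t\le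 n$ $$\left(\Gamma_n(f_\theta)^{-1}-C_n(f_\theta^{-1})\right)_{s,t}=\left(F_n^*\Delta_n(f_\theta^{-1})D_n(f_\theta)\right)_{s,t}=\begin{cases}\sigma^{-2}\sum_{\ell=0}^{p-t}\phi_{\ell+t}\widetilde{\phi}_{(\ell+s)\bmod n} & 1\le t\le p\\ \sigma^{-2}\sum_{\ell=1}^{p-(n-t)}\phi_{\ell+(n-t)}\widetilde{\phi}_{(\ell-s)\bmod n} & n-p+1\le t\le n\\ 0&\text{otherwise.}\end{cases}$$
   Context: Observations $X_1,\ldots,X_n$ and AR coefficients $\phi_u$ are real, and $\sigma^2>0$; $\phi_p(\cdot)$ denotes the function and $\phi_p$ the last AR coefficient. For a spectral density $f$ with autocovariance $c_f$, $f(\omega)=\sum_{r}c_f(r)e^{ir\omega}$, $\Gamma_n(f)_{s,t}=c_f(s-t)$ ($n\times n$). $\omega_{k,n}=2\pi k/n$; $(F_n)_{k,t}=n^{-1/2}e^{it\omega_{k,n}}$; $\Delta_n(g)=\mathrm{diag}(g(\omega_{1,n}),\ldots,g(\omega_{n,n}))$; $C_n(g)=F_n^*\Delta_n(g)F_n$, where $A^*$ is the conjugate transpose. For $\tau\le 0$ and $\tau>n$, $\{\phi_{t,n}(\tau;f)\}_{t=1}^n$ are the coefficients of the best (in mean square) linear predictor of $X_\tau$ given $X_1,\ldots,X_n$ for a zero mean series with autocovariance $c_f$, and $\widehat{X}_{\tau,n}=\sum_{t=1}^n\phi_{t,n}(\tau;f)X_t$. The predictive DFT is $\widehat{J}_n(\omega;f)=n^{-1/2}\sum_{\tau\le0}\widehat{X}_{\tau,n}e^{i\tau\omega}+n^{-1/2}\sum_{\tau>n}\widehat{X}_{\tau,n}e^{i\tau\omega}$,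 and $$D_{n}(f)_{k,t}= n^{-1/2}\sum_{\tau\leq 0}\left(\phi_{t,n}(\tau;f)e^{i\tau\omega_{k,n}}+\phi_{n+1-t,n}(\tau;f)e^{-i(\tau-1)\omega_{k,n}}\right).$$ Residues $m\bmod n$ are taken in $\{0,1,\ldots,n-1\}$.
   Formalization: The claim that D_n(f_θ) has rank 2p is proved under the added assumption that the last AR coefficient φ_p is nonzero (when p ≥ 1); without it the claim is false, e.g. p=1, n=2, φ_1=0 gives D_n=0. All other claims are proved without this assumption. *)

(* Defs.v *)
From HB Require Import structures.
From mathcomp Require Import all_boot all_order all_algebra complex.
From mathcomp Require Import all_classical all_reals all_analysis.

Set Implicit Arguments.
Unset Strict Implicit.
Unset Printing Implicit Defensive.

Import Order.TTheory GRing.Theory Num.Theory.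
Import numFieldNormedType.Exports.

Local Open Scope classical_set_scope.
Local Open Scope ring_scope.
Local Open Scope complex_scope.
Local Open Scope sesquilinear_scope.

Section Defs.
Variable R : realType.
Implicit Types (f g : R -> R) (c : int -> R) (phi : nat -> R).

(* The exponential e^{ix} for real x. *)
Definition expi (x : R) : R[i] := cos x +i* sin x.

(* [R[i]^o] is [R[i]] with the topology of its modulus. *)
Definition csum (u : nat -> R[i]) : R[i] := limn (series (u : nat -> R[i]^o)).

Definition csummable (u : nat -> R[i]) : Prop :=
  cvgn (series (u : nat -> R[i]^o)).

(* [f(w) = \sum_(r in Z) c(r) e^{irw}] for every [w], with [c] absolutely
   summable, so that the order of summation is immaterial and [c] is
   determined by [f]. *)
Definition is_autocov f c : Prop :=
  cvgn (series (fun r : nat => `|c r%:Z| + `|c (- r%:Z)| : R)) /\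
  forall w : R,
    (fun N : nat => \sum_(r < N.*2.+1)
       (c (r%:Z - N%:Z))%:C * expi ((r%:Z - N%:Z)%:~R * w) : R[i]^o)
      @ \oo --> ((f w)%:C : R[i]^o).

Definition autocov f : int -> R := xget (fun=> 0) [set c | is_autocov f c].

(* Rows and columns numbered 1, ..., n on paper are indexed here by ['I_n],
   the ordinal [i] standing for [i.+1]. *)
Definition Gamma n f : 'M[R]_n := \matrix_(s, t) autocov f (s%:Z - t%:Z).

Definition omega n (k : nat) : R := 2 * pi * k%:R / n%:R.

Definition Fmx n : 'M[R[i]]_n :=
  \matrix_(k, t) ((Num.sqrt n%:R)^-1%:C * expi (t.+1%:R * omega n k.+1)).

Definition Delta n g : 'M[R[i]]_n :=
  diag_mx (\row_k (g (omega n k.+1))%:C).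

Definition circ n g : 'M[R[i]]_n := (Fmx n) ^t* *m Delta n g *m Fmx n.

(* The mean square error [E (Y_tau - \sum_(1 <= t <= n) a_t Y_t)^2] for a zero
   mean series [Y] with autocovariance [c]; see [pred_mseE]. *)
Definition pred_mse c n (tau : int) (a : 'rV[R]_n) : R :=
  c 0 - 2 * (\sum_(t < n) a 0 t * c (tau - t.+1%:Z))
  + \sum_(s < n) \sum_(t < n) a 0 s * a 0 t * c (s.+1%:Z - t.+1%:Z).

Definition is_best_pred c n tau (a : 'rV[R]_n) : Prop :=
  forall b : 'rV[R]_n, pred_mse c tau a <= pred_mse c tau b.

Definition pred_coef n f (tau : int) : 'rV[R]_n :=
  xget 0 [set a | is_best_pred (autocov f) tau a].

(* The observations are [X 1], ..., [X n]; other values of [X] are not used. *)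
Definition Xhat n f (X : nat -> R) (tau : int) : R :=
  \sum_(t < n) pred_coef n f tau 0 t * X t.+1.

(* The terms of the predictive DFT at [tau = - j] and at [tau = n + 1 + j]. *)
Definition Jhat_left n f X w (j : nat) : R[i] :=
  (Xhat n f X (- j%:Z))%:C * expi ((- j%:Z)%:~R * w).

Definition Jhat_right n f X w (j : nat) : R[i] :=
  (Xhat n f X (n.+1 + j)%N%:Z)%:C * expi ((n.+1 + j)%N%:R * w).

Definition Jhat n f X (w : R) : R[i] :=
  (Num.sqrt n%:R)^-1%:C * csum (Jhat_left n f X w)
  + (Num.sqrt n%:R)^-1%:C * csum (Jhat_right n f X w).

(* The term at [tau = - j]; if [t] stands for the column [t.+1], then
   [rev_ord t] stands for the column [n + 1 - t.+1]. *)
Definition Dmx_term n f (k t : 'I_n) (j : nat) : R[i] :=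
  let tau : int := - j%:Z in
  (pred_coef n f tau 0 t)%:C * expi (tau%:~R * omega n k.+1)
  + (pred_coef n f tau 0 (rev_ord t))%:C
    * expi (- (tau - 1)%:~R * omega n k.+1).

Definition Dmx n f : 'M[R[i]]_n :=
  \matrix_(k, t) ((Num.sqrt n%:R)^-1%:C * csum (Dmx_term f k t)).

(* The AR coefficients are [phi 1], ..., [phi p]; other values of [phi] are
   not used. *)
Definition ar_charpoly p phi : {poly R[i]} :=
  1 - \sum_(1 <= u < p.+1) (phi u)%:C *: 'X^u.

Definition ar_fun p phi (w : R) : R[i] :=
  1 - \sum_(1 <= u < p.+1) (phi u)%:C * expi (- (u%:R * w)).

Definition ar_density (sigma : R) p phi (w : R) : R :=
  sigma ^+ 2 * (complex.Re `|ar_fun p phi w|) ^- 2.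

Definition ar_phi p phi (j : nat) (w : R) : R[i] :=
  (ar_fun p phi w)^-1
  * \sum_(0 <= s < (p - j).+1) (phi (j + s)%N)%:C * expi (- (s%:R * w)).

Definition ar_tilde p phi (m : int) : R :=
  if m is Posz s then
    if s == 0%N then 1 else if (s <= p)%N then - phi s else 0
  else 0.

End Defs.

Section PredMse.
Context d (T : measurableType d) (R : realType) (P : probability T R).

Let mean (g : T -> R) (m : R) := (g \in Lfun P 1) /\ ('E_P[g] = m%:E)%E.

Let meanD g h a b : mean g a -> mean h b -> mean (g \+ h)%R (a + b).
Proof.
move=> [g1 ga] [h1 hb]; split; first exact: rpredD.
by rewrite expectationD// ga hb.
Qed.

Let meanZ g a k : mean g a -> mean (k \o* g)%R (k * a).
Proof.
move=> [g1 ga]; split; last by rewrite expectationZl// ga.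
have -> : (k \o* g) = k *: g by apply/funext => x /=; rewrite mulrC.
exact: rpredZ.
Qed.

Let mean_sum (I : Type) (r : seq I) (g : I -> T -> R) (a : I -> R) :
  (forall i, mean (g i) (a i)) ->
  mean (fun x => \sum_(i <- r) g i x) (\sum_(i <- r) a i).
Proof.
move=> ga; elim: r => [|i r IH].
  have -> : (fun x => \sum_(i <- [::]) g i x) = cst 0.
    by apply/funext => x; rewrite big_nil.
  by rewrite big_nil; split; [exact: rpred0|rewrite expectation_cst].
have -> : (fun x => \sum_(j <- i :: r) g j x)
    = (g i \+ (fun x => \sum_(i <- r) g i x))%R.
  by apply/funext => x; rewrite big_cons.
by rewrite big_cons; exact: meanD.
Qed.

Lemma pred_mseE (Y : int -> {RV P >-> R}) (c : int -> R) n (tau : int)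
    (a : 'rV[R]_n) :
  (forall s, (Y s : T -> R) \in Lfun P 2%:E) ->
  (forall s, ('E_P[Y s] = 0)%E) ->
  (forall s t, covariance P (Y s) (Y t) = (c (s - t))%:E) ->
  ('E_P[(fun x => (Y tau x - \sum_(t < n) a 0 t * Y t.+1%:Z x) ^+ 2)%R]
    = (pred_mse c tau a)%:E)%E.
Proof.
move=> Y2 Y0 Yc.
have Y1 s : (Y s : T -> R) \in Lfun P 1 by apply: Lfun_subset12 => //; exact: fin_num_measure.
have mY s t : mean (Y s \* Y t)%R (c (s - t)).
  have YY : (Y s \* Y t)%R \in Lfun P 1 by exact: Lfun2_mul_Lfun1.
  split => //.
  by rewrite -Yc covarianceE// !Y0 mule0 sube0.
have := meanD (meanD (mY tau tau) (meanZ (- 2) (mean_sum (index_enum 'I_n)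
    (fun t : 'I_n => meanZ (a 0 t) (mY tau t.+1%:Z)))))
  (mean_sum (index_enum 'I_n) (fun s : 'I_n => mean_sum (index_enum 'I_n)
    (fun t : 'I_n => meanZ (a 0 s * a 0 t) (mY s.+1%:Z t.+1%:Z)))).
rewrite subrr mulNr => -[_ <-]; congr expectation.
apply/funext => x /=.
rewrite sqrrB expr2 mulrN; congr (_ - _ + _).
  rewrite -mulr_natr; congr (_ * _); rewrite big_distrr/=.
  by apply: eq_bigr => t _; rewrite mulrCA mulrC.
rewrite expr2 big_distrlr/=; apply: eq_bigr => s _; apply: eq_bigr => t _.
by rewrite mulrACA mulrC.
Qed.

End PredMse.

(* Main.v *)
Require Import Defs.
From HB Require Import structures.
From mathcomp Require Import all_boot all_order all_algebra complex.
From mathcomp Require Import all_classical all_reals all_analysis.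
From mathcomp Require Import ring lra zify.

Set Implicit Arguments.
Unset Strict Implicit.
Unset Printing Implicit Defensive.

Import Order.TTheory GRing.Theory Num.Theory.
Import numFieldNormedType.Exports.

Local Open Scope classical_set_scope.
Local Open Scope ring_scope.
Local Open Scope complex_scope.
Local Open Scope sesquilinear_scope.

(** Write [phi(z) = 1 - sum_u phi_u z^u], so that
    [f = sigma^2 / (phi(z) phi(1/z))] at [z = e^{iw}].

    Autocovariances. Causality makes [phi(z)] and its reciprocal polynomial
    [z^p phi(1/z)] coprime, and a Bezout relation between them splits [f] into
    a trigonometric polynomial times [1/phi(z)] plus one times [1/phi(1/z)].
    Both inverses are one-sided absolutely summable power series
    ([abs_summable_deconv]), so [f] has a summable autocovariance [c]
    ([ar_density_autocov]). Averages over roots of unity recover [c] from [f]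
    ([fourier_mean]); hence [c] is determined by [f], is even, is positive
    definite because [f] is bounded below ([ar_autocov_posdef]), and satisfies
    the Yule-Walker equations because [phi(z) f = sigma^2 / phi(1/z)] has no
    positive frequency ([yule_walker]).

    Prediction. Positive definiteness makes the best predictor the only
    solution of the normal equations ([best_pred_unique]). Running the AR
    recursion past the end of the sample solves them ([ar_weight_normal]), and
    evenness of [c] gives the same weights, reflected, before its beginning.
    As functions of the number of steps, these weights satisfy the AR recursion
    with a finite input. Therefore their Fourier sum is that input divided by
    [phi], which is the boundary function [phi_{l,p}]; the formulas for the
    predictive DFT and for [D] are sums of these ([has_csum_weight],
    [has_csum_Dmx_term]).

    Inverse of [Gamma]. The predictors have the right covariances with the
    observations, so [F + D], which is the DFT of the completed series,
    satisfies [(F + D) Gamma = Delta(f) F] ([Dmx_Gamma]). Multiplying by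
    [F^* Delta(1/f)] on the left gives [Gamma^{-1} = C_n(1/f) + F^* Delta(1/f) D].
    Here [phi_{l,p} / f] is a trigonometric polynomial, whose frequencies are
    folded modulo [n] by the [n] sampling points ([circulant_phi0]).

    Rank. A linear dependency between the [2p] boundary columns becomes, after
    clearing denominators, a polynomial of degree below [2p] with [n >= 2p]
    roots. It vanishes, and coprimality of [phi] with its reciprocal together
    with [phi_p <> 0] forces the dependency to be trivial ([boundary_free]). *)

(** * Summable sequences and multiplication of power series by polynomials *)

Section AbsSummable.
Variable K : numDomainType.
Implicit Types y : nat -> K.

(** Stated by bounded partial sums, to make sense over the real and the complex
    numbers alike. *)
Definition abs_summable y := exists M, forall N, \sum_(j < N) `|y j| <= M.

Lemma abs_summable_le y1 y2 : (forall j, `|y1 j| <= `|y2 j|) ->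
  abs_summable y2 -> abs_summable y1.
Proof. by move=> y12 [M yM]; exists M => N; rewrite (le_trans _ (yM N))// ler_sum. Qed.

Lemma eq_abs_summable y1 y2 : y1 =1 y2 -> abs_summable y1 -> abs_summable y2.
Proof. by move=> /funext ->. Qed.

Lemma abs_summableD y1 y2 : abs_summable y1 -> abs_summable y2 ->
  abs_summable (fun j => y1 j + y2 j).
Proof.
move=> [M yM] [M' yM']; exists (M + M') => N.
apply: le_trans (lerD (yM N) (yM' N)); rewrite -big_split.
by apply: ler_sum => j _; exact: ler_normD.
Qed.

Lemma abs_summableZ k y : abs_summable y -> abs_summable (fun j => k * y j).
Proof.
move=> [M yM]; exists (`|k| * M) => N.
under eq_bigr do rewrite normrM.
by rewrite -mulr_sumr ler_wpM2l.
Qed.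

Lemma abs_summableS y : abs_summable (fun j => y j.+1) <-> abs_summable y.
Proof.
split=> -[M yM].
  exists (`|y 0%N| + M) => -[|N]; last by rewrite big_ord_recl lerD// yM.
  by rewrite big_ord0 addr_ge0// (le_trans _ (yM 0%N))// big_ord0.
exists M => N; apply: le_trans (yM N.+1).
by rewrite big_ord_recl lerDr.
Qed.

Lemma abs_summable_finite y N :
  (forall j, (N <= j)%N -> y j = 0) -> abs_summable y.
Proof.
move=> y0; exists (\sum_(j < N) `|y j|) => m.
have [mN|Nm] := leqP m N.
  rewrite -!(big_mkord xpredT (fun j => `|y j|)) (big_cat_nat _ (n := m) (p := N))//=.
  by rewrite lerDl sumr_ge0.
rewrite -!(big_mkord xpredT (fun j => `|y j|)) (big_cat_nat _ (n := N) (p := m))//=; last exact: ltnW.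
rewrite [X in _ + X]big_nat_cond [X in _ + X]big1 ?addr0// => j /andP[/andP[Nj _] _].
by rewrite y0// normr0.
Qed.

End AbsSummable.

Section PowerSeries.
Variable K : numDomainType.
Implicit Types (P Q : {poly K}) (y : nat -> K).

(** The coefficients of the product of [P] with the formal power series of
    coefficients [y]. *)
Definition conv P y (j : nat) : K := \sum_(u < j.+1) P`_u * y (j - u)%N.

(** Up to a given degree a power series may be truncated, which transports the
    ring laws of [{poly K}] to [conv]. *)
Lemma conv_poly P y N j : (j < N)%N ->
  conv P y j = (P * \poly_(i < N) y i)`_j.
Proof.
move=> jN; rewrite coefM; apply: eq_bigr => u _.
by rewrite coef_poly (leq_ltn_trans (leq_subr _ _) jN).
Qed.

Lemma convM P Q y j : conv (P * Q) y j = conv P (conv Q y) j.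
Proof.
rewrite (@conv_poly _ _ j.+1)// -mulrA coefM; apply: eq_bigr => u _.
by rewrite (@conv_poly _ _ j.+1)// ltnS leq_subr.
Qed.

Lemma convC c y j : conv c%:P y j = c * y j.
Proof.
rewrite /conv big_ord_recl /= subn0 coefC eqxx big1 ?addr0// => u _.
by rewrite coefC mul0r.
Qed.

Lemma convD P Q y j : conv (P + Q) y j = conv P y j + conv Q y j.
Proof. by rewrite -big_split; apply: eq_bigr => u _; rewrite coefD mulrDl. Qed.

Lemma conv_mulX P y j :
  conv (P * 'X) y j = if j is j'.+1 then conv P y j' else 0.
Proof.
case: j => [|j]; first by rewrite /conv big_ord1 coefMX mul0r.
rewrite /conv big_ord_recl coefMX mul0r add0r; apply: eq_bigr => u _.
by rewrite coefMX /= /bump /= add1n subSS.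
Qed.

Lemma conv_inj P y1 y2 : P`_0 = 1 -> conv P y1 =1 conv P y2 -> y1 =1 y2.
Proof.
move=> P0 y12 j; have [m] := ubnP j; elim: m j => // m IHm j jm.
have := y12 j; rewrite /conv !big_ord_recl P0 !mul1r subn0.
have -> : \sum_(i < j) P`_(lift ord0 i) * y1 (j - lift ord0 i)%N
    = \sum_(i < j) P`_(lift ord0 i) * y2 (j - lift ord0 i)%N.
  apply: eq_bigr => i _; rewrite IHm// lift0.
  by have := ltn_ord i; lia.
exact: addIr.
Qed.

End PowerSeries.

(** For [g = (X - z) y], one has [|z| |y_j| <= |g_j| + |y_(j-1)|]; summing over
    [j] gives [(|z| - 1) sum |y_j| <= sum |g_j|]. *)
Lemma abs_summable_deconv_root (K : numFieldType) (z : K) y :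
  1 < `|z| -> abs_summable (conv ('X - z%:P) y) -> abs_summable y.
Proof.
move=> z1 [M yM]; have z1' : 0 < `|z| - 1 by rewrite subr_gt0.
exists (M / (`|z| - 1)) => N; rewrite ler_pdivlMr//.
apply: (le_trans _ (yM N)).
have convE j : conv ('X - z%:P) y j = (if j is j'.+1 then y j' else 0) - z * y j.
  rewrite -polyCN -[X in X + _]mul1r convD conv_mulX convC mulNr.
  by case: j => // j; rewrite -[1]/(1%:P) convC mul1r.
(* the last term pays for the factor [|z|] of the next summand *)
suff: (\sum_(j < N) `|y j|) * (`|z| - 1)
      + `|if N is j.+1 then y j else 0| <= \sum_(j < N) `|conv ('X - z%:P) y j|.
  by apply: le_trans; rewrite lerDl.
elim: N => [|N IHN]; first by rewrite !big_ord0 mul0r normr0 addr0.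
rewrite !big_ord_recr/= mulrDl [`|y N| * _]mulrBr mulr1 -addrA subrK.
apply: le_trans (lerD IHN (lexx _)); rewrite -addrA lerD2l convE distrC.
by rewrite -normrM mulrC -lerBlDl lerB_dist.
Qed.

(** Stability: a series whose product with [P] is summable is itself summable
    when the roots of [P] lie outside the unit disc. They are divided out one
    at a time. *)
Lemma abs_summable_deconv (K : numClosedFieldType) (P : {poly K}) y :
  (forall z, root P z -> 1 < `|z|) ->
  abs_summable (conv P y) -> abs_summable y.
Proof.
have [m] := ubnP (size P); elim: m P y => // m IHm P y sP Pz.
have P0 : P != 0.
  by apply/eqP => P0; have := Pz 0; rewrite P0 root0 normr0 ltr10 => /(_ isT).
have [sP1|sP1] := eqVneq (size P) 1%N.
  have /size_poly1P[c c0 ->] : size P == 1%N by rewrite sP1.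
  move=> [M cM]; exists (`|c|^-1 * M) => N; rewrite -ler_pdivrMl ?invr_gt0 ?normr_gt0//.
  rewrite invrK mulr_sumr (le_trans _ (cM N))// ler_sum// => j _.
  by rewrite convC normrM.
have /closed_rootP[z /[dup] rz /factor_theorem[Q PQ]] := sP1.
move: sP Pz; rewrite PQ => sP Pz cP.
have Q0 : Q != 0 by apply: contra_neq P0; rewrite PQ => ->; rewrite mul0r.
apply: (abs_summable_deconv_root (Pz z _)); first by rewrite rootM root_XsubC eqxx orbT.
apply: (IHm Q).
- by rewrite size_Mmonic ?monicXsubC// size_XsubC addn2 in sP.
- by move=> w rw; apply: Pz; rewrite rootM rw.
- by case: cP => M cM; exists M => N; under eq_bigr do rewrite -convM; exact: cM.
Qed.

(** Power series division: [P * y = g] is solved from the constant term on. *)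
Lemma conv_surj (K : numDomainType) (P : {poly K}) (g : nat -> K) : P`_0 = 1 ->
  exists y : nat -> K, forall j, conv P y j = g j.
Proof.
move=> P0; rewrite /conv.
(* [h j] lists the solution backwards, from [y_(j-1)] down to [y_0] *)
pose fix h (j : nat) : seq K := if j is j'.+1 then
  (g j' - \sum_(u < j') P`_u.+1 * nth 0 (h j') u) :: h j' else [::].
have hS i j : nth 0 (h (j + i).+1) i = head 0 (h j.+1).
  by elim: i j => [|i IH] j; [rewrite addn0 | rewrite -IH addnS].
exists (fun j => head 0 (h j.+1)) => j.
rewrite big_ord_recl P0 mul1r subn0 [X in X + _]/= addrC.
rewrite [X in X + _](_ : _ = \sum_(u < j) P`_u.+1 * nth 0 (h j) u) ?subrKC//.
apply: eq_bigr => u _; rewrite lift0 -(hS u).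
by rewrite -addnS subnK.
Qed.

(** * Reciprocal polynomials *)

Definition rev_poly (K : nzRingType) N (P : {poly K}) : {poly K} :=
  \poly_(i < N.+1) P`_(N - i).

Lemma map_rev_poly (K L : nzRingType) (f : {rmorphism K -> L}) N P :
  map_poly f (rev_poly N P) = rev_poly N (map_poly f P).
Proof.
apply/polyP => i; rewrite coef_map /rev_poly.
rewrite (coef_poly N.+1 (fun i => P`_(N - i))).
rewrite (coef_poly N.+1 (fun i => (map_poly f P)`_(N - i))).
by case: (i < N.+1)%N; [rewrite coef_map | exact: rmorph0].
Qed.

Lemma horner_rev_poly (K : fieldType) N (P : {poly K}) z :
  (size P <= N.+1)%N -> z != 0 -> (rev_poly N P).[z] = z ^+ N * P.[z^-1].
Proof.
move=> sP z0; rewrite !(@horner_coef_wide _ N.+1) ?size_poly//.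
rewrite mulr_sumr (reindex_inj rev_ord_inj)/=; apply: eq_bigr => i _.
have iN : (i <= N)%N by rewrite -ltnS.
rewrite coef_poly subSS ltnS leq_subr subKn// mulrCA; congr (_ * _).
by rewrite exprVn expfB_cond// (negPf z0) add0n.
Qed.
(** * The complex exponential and roots of unity *)

Section Expi.
Variable R : realType.
Implicit Types x w : R.

Lemma expi0 : expi 0 = 1 :> R[i].
Proof. by rewrite /expi cos0 sin0. Qed.

Lemma expiD x w : expi (x + w) = expi x * expi w.
Proof.
by rewrite /expi cosD sinD; congr (_ +i* _); rewrite addrC.
Qed.

Lemma conj_expi x : (expi x)^* = expi (- x).
Proof. by rewrite /expi cosN sinN. Qed.

Lemma normr_expi x : `|expi x| = 1.
Proof. by rewrite /expi normc_def /= cos2Dsin2 sqrtr1. Qed.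

Lemma expi_neq0 x : expi x != 0.
Proof. by rewrite -normr_eq0 normr_expi oner_eq0. Qed.

Lemma expiN x : expi (- x) = (expi x)^-1.
Proof.
apply: (mulfI (expi_neq0 x)); rewrite divff ?expi_neq0//.
by rewrite -expiD subrr expi0.
Qed.

Lemma expiMn x j : expi (j%:R * x) = expi x ^+ j.
Proof.
elim: j => [|j IH]; first by rewrite mul0r expi0.
by rewrite mulrSr mulrDl mul1r expiD IH exprSr.
Qed.

Lemma expi_2pi (r : int) : expi (r%:~R * (2 * pi)) = 1 :> R[i].
Proof.
have e1 : expi (2 * pi) = 1 :> R[i].
  by rewrite /expi mulr_natl cos2pi mulr2n sinD sinpi !mulr0 mul0r addr0.
case: r => j; first by rewrite expiMn e1 expr1n.
by rewrite NegzE mulrNz mulNr expiN expiMn e1 expr1n invr1.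
Qed.

Lemma expi_omega_neq1 n m : (0 < m < n)%N -> expi (omega R n m) != 1.
Proof.
move=> /andP[m0 mn]; have n0 : (0 : R) < n%:R by rewrite ltr0n (leq_trans _ mn).
set x := omega R n m.
have x0 : 0 < x by rewrite /x /omega divr_gt0// mulr_gt0 ?ltr0n// mulr_gt0 ?pi_gt0.
have x2 : x < 2 * pi.
  by rewrite /x /omega ltr_pdivrMr// ltr_pM2l ?ltr_nat// mulr_gt0 ?pi_gt0.
apply/negP => /eqP; rewrite /expi => -[c1 _].
have cosI (y : R) : 0 <= y <= pi -> cos y = 1 -> y = 0.
  move=> y0pi; rewrite -cos0; apply: cos_inj; first by rewrite in_itv.
  by rewrite in_itv/= lexx pi_ge0.
have [xpi|pix] := leP x pi.
  by have := x0; rewrite (cosI x) ?ltxx// xpi ltW.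
have : 2 * pi - x = 0.
  apply: cosI; first by rewrite subr_ge0 ltW//= lerBlDr mulr2n mulrDl mul1r lerD2l ltW.
  by rewrite addrC mulr_natl cosD2pi cosN.
by move/eqP; rewrite subr_eq0 gt_eqF.
Qed.

End Expi.

Lemma expi_omega_period (R : realType) n (m : int) k : (0 < n)%N ->
  expi ((n%:Z * m)%:~R * omega R n k) = 1.
Proof.
move=> n0; have nR0 : (n%:R : R) != 0 by rewrite pnatr_eq0 -lt0n.
rewrite -(expi_2pi R (m * k%:Z)) /omega !intrM; congr expi.
by rewrite -[n%:Z%:~R]/(n%:R : R) -[k%:Z%:~R]/(k%:R : R); field.
Qed.

(** A geometric sum whose ratio is an [n]-th root of unity. *)
Lemma sum_expi_omega (R : realType) n (r : int) : (0 < n)%N ->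
  \sum_(k < n) expi (r%:~R * omega R n k) = if (n%:Z %| r)%Z then n%:R else 0.
Proof.
move=> n0; have nR0 : (n%:R : R) != 0 by rewrite pnatr_eq0 -lt0n.
have nZ0 : n%:Z != 0 by rewrite -lt0n in n0 *.
pose x : R[i] := expi (r%:~R * omega R n 1).
have xk (k : 'I_n) : expi (r%:~R * omega R n k) = x ^+ k.
  by rewrite -expiMn /omega mulr1; congr expi; rewrite -[RHS]mulrC; ring.
under eq_bigr do rewrite xk.
case: ifPn => [/dvdzP[q rq]|nr].
  have -> : x = 1 by rewrite /x rq [q * _]mulrC expi_omega_period.
  by under eq_bigr do rewrite expr1n; rewrite sumr_const card_ord.
have x1 : x != 1.
  rewrite /x (divz_eq r n%:Z) [X in X + _]mulrC intrD mulrDl expiD expi_omega_period// mul1r.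
  have m0 : (0 <= r %% n%:Z)%Z by rewrite modz_ge0.
  have mn : ((r %% n%:Z)%Z < n%:Z) by rewrite ltz_pmod.
  have := nr; rewrite (sameP dvdz_mod0P eqP).
  case: (r %% n%:Z)%Z m0 mn => // m _; rewrite ltz_nat => mn m0.
  rewrite -[m%:~R]/(m%:R) /omega mulr1.
  have -> : m%:R * (2 * pi / n%:R) = omega R n m :> R by rewrite /omega; ring.
  by rewrite expi_omega_neq1// mn andbT lt0n.
have xn : x ^+ n = 1.
  by rewrite -expiMn mulrA -[n%:R]/(n%:Z%:~R) -intrM expi_omega_period.
have := subrX1 x n; rewrite xn subrr => /esym/eqP; rewrite mulf_eq0 subr_eq0 (negPf x1).
by move/eqP.
Qed.

Lemma sum_expi_omegaS (R : realType) n (r : int) : (0 < n)%N ->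
  \sum_(k < n) expi (r%:~R * omega R n k.+1) = if (n%:Z %| r)%Z then n%:R else 0.
Proof.
move=> n0.
have step (k : 'I_n) : expi (r%:~R * omega R n k.+1)
    = expi (r%:~R * omega R n 1) * expi (r%:~R * omega R n k).
  by rewrite -expiD; congr expi; rewrite /omega -nat1r; ring.
under eq_bigr do rewrite step.
rewrite -mulr_sumr sum_expi_omega//; case: ifP => [/dvdzP[q ->]|_]; last exact: mulr0.
by rewrite mulrC [q * _]mulrC expi_omega_period// mulr1.
Qed.

Lemma expi_omegaS_inj (R : realType) n : injective (fun k : 'I_n => expi (omega R n k.+1)).
Proof.
have lt_neq (k1 k2 : 'I_n) : (k1 < k2)%N -> expi (omega R n k1.+1) != expi (omega R n k2.+1).
  move=> lt_k; have := @expi_omega_neq1 R n (k2 - k1)%N.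
  rewrite subn_gt0 lt_k (leq_ltn_trans (leq_subr _ _))// => /(_ isT).
  apply: contra_neq => e12; have -> : omega R n (k2 - k1) = omega R n k2.+1 - omega R n k1.+1.
    by rewrite /omega natrB 1?ltnW// -!nat1r; ring.
  by rewrite expiD -e12 -expiD subrr expi0.
move=> k1 k2 e12.
by have [/lt_neq|/lt_neq|/val_inj//] := ltngtP k1 k2; rewrite e12 eqxx.
Qed.

(** * Convergent complex series *)

Lemma abs_summableP (R : realType) (y : nat -> R) :
  abs_summable y <-> cvgn (series (fun j => `|y j|)).
Proof.
have ndy : nondecreasing_seq (series (fun j => `|y j|)).
  by apply: nondecreasing_series => j _ _; exact: normr_ge0.
split=> [[M yM]|cy].
  apply: nondecreasing_is_cvgn => //; exists M => _ [N _ <-].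
  by rewrite seriesEord; exact: yM.
exists (limn (series (fun j => `|y j|))) => N.
by have := nondecreasing_cvgn_le ndy cy N; rewrite /series/= big_mkord.
Qed.

Lemma abs_summable_tail (R : realType) (y : nat -> R) (e : R) :
  abs_summable y -> 0 < e ->
  exists M, forall N, \sum_(j < N) `|y (M + j)%N| <= e.
Proof.
move=> /abs_summableP cy e0.
have ndy : nondecreasing_seq (series (fun j => `|y j|)).
  by apply: nondecreasing_series => j _ _; exact: normr_ge0.
have /cvgrPdist_lt/(_ _ e0)[M _ /(_ M (leqnn M))/=] := cy.
move=> /(le_lt_trans (ler_norm _)) /ltW; rewrite lerBlDr => h.
exists M => N; rewrite -(lerD2r (series (fun j => `|y j|) M)).
apply: le_trans h; rewrite -[leLHS](_ : series (fun j => `|y j|) (N + M) = _).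
  exact: nondecreasing_cvgn_le.
rewrite series_addn addrC; congr (_ + _).
rewrite -[X in index_iota X _]add0n big_addn addnK big_mkord.
by apply: eq_bigr => i _; rewrite addnC.
Qed.

Section ComplexSeries.
Variable R : realType.
Implicit Types (u v : nat -> R[i]) (l : R[i]).

(** Naming this predicate confines the alias [R[i]^o], which carries the
    topology, to its elementary properties. *)
Definition clim u l : Prop := (u : nat -> R[i]^o) @ \oo --> (l : R[i]^o).

Lemma normci : `| 'i%C : R[i] | = 1.
Proof. by rewrite normc_def /= expr0n expr1n add0r sqrtr1. Qed.

Lemma normc_real (x : R) : `| x%:C | = `|x|%:C.
Proof. by rewrite normc_def /= expr0n addr0 sqrtr_sqr. Qed.

Lemma clim_ReIm u l :
  (fun j => complex.Re (u j)) @ \oo --> complex.Re l ->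
  (fun j => complex.Im (u j)) @ \oo --> complex.Im l -> clim u l.
Proof.
move=> /cvgrPdist_lt ure /cvgrPdist_lt uim; apply/cvgrPdist_lt => e e0.
have eE : (complex.Re e)%:C = e by rewrite RRe_real// gtr0_real.
have {}e0 : 0 < complex.Re e / 2 by rewrite divr_gt0// -ltcR eE.
near=> j.
rewrite -eE [complex.Re e]splitr rmorphD/= [_ - _]complexE.
apply: le_lt_trans (ler_normD _ _) _; rewrite normrM normci mul1r !normc_real.
rewrite !raddfB/=; apply: ltrD; rewrite ltcR; near: j; [exact: ure|exact: uim].
Unshelve. all: by end_near. Qed.

Lemma climD u v l m : clim u l -> clim v m -> clim (fun j => u j + v j) (l + m).
Proof. by move=> ul vm; exact: (cvgD (ul : _ --> (l : R[i]^o)) vm). Qed.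

Lemma climZ k u l : clim u l -> clim (fun j => k * u j) (k * l).
Proof. by move=> ul; exact: (cvgZl_tmp (V := R[i]^o) ul). Qed.

Arguments climZ k [u l] _.

Lemma clim_cst l : clim (fun=> l) l.
Proof. exact: (@cvg_cst (R[i]^o)). Qed.

Arguments clim_cst l : clear implicits.

Lemma clim_uniq u l m : clim u l -> clim u m -> l = m.
Proof. by move=> ul um; apply: (cvg_unique _ ul um); exact: norm_hausdorff. Qed.

Lemma climS u l : clim (fun j => u j.+1) l <-> clim u l.
Proof. by rewrite /clim -(@cvg_shiftS (R[i]^o) u). Qed.

Lemma clim_norm_le u l b : (forall j, `|u j| <= b) -> clim u l -> `|l| <= b.
Proof.
move=> ub /cvgrPdist_lt ul.
have bR : b \is Num.real by rewrite ger0_real// (le_trans _ (ub 0%N)).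
rewrite real_leNgt ?normr_real//; apply/negP => bl.
have := ul (`|l| - b); rewrite subr_gt0 => /(_ bl)[N _ /(_ N (leqnn N))]/=.
rewrite ltrBrDr => h; suff: `|l| < `|l| by rewrite ltxx.
apply: le_lt_trans h; rewrite -[l in leLHS](subrK (u N)).
by rewrite (le_trans (ler_normD _ _))// lerD2l.
Qed.

Lemma abs_summable_toC (y : nat -> R) :
  abs_summable y <-> abs_summable (fun j => (y j)%:C).
Proof.
split=> -[M yM].
  exists M%:C => N; under eq_bigr do rewrite normc_real.
  by rewrite -rmorph_sum lecR.
exists (complex.Re M) => N; have := yM N; under eq_bigr do rewrite normc_real.
by rewrite -rmorph_sum lecE /= => /andP[].
Qed.

Definition has_csum u l := clim (fun N => \sum_(j < N) u j) l.

Lemma has_csum_exists u : abs_summable u -> exists l, has_csum u l.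
Proof.
move=> [M uM].
have MR : M \is Num.real by rewrite ger0_real// (le_trans _ (uM 0%N))// big_ord0.
have cvgf (f : R[i] -> R) : (forall z, `|f z|%:C <= `|z|) ->
    cvgn (series (fun j => f (u j))).
  move=> fz; apply: normed_cvg; apply/abs_summableP; exists (complex.Re M) => N.
  rewrite -lecR RRe_real// rmorph_sum/= (le_trans _ (uM N))//.
  by apply: ler_sum => j _; exact: fz.
have fS (f : {additive R[i] -> R}) N :
    f (\sum_(j < N) u j) = series (fun j => f (u j)) N.
  by rewrite seriesEord raddf_sum.
have /cvg_ex[a ua] := cvgf _ (@normc_ge_Re R).
have /cvg_ex[b ub] : cvgn (series (fun j => complex.Im (u j))).
  apply: (cvgf (@complex.Im R)) => z.
  by rewrite -[leRHS]mulr1 -normci -normrM -normrN -ReiNIm normc_ge_Re.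
exists (a +i* b); apply: clim_ReIm.
  by under eq_fun do rewrite (fS (@complex.Re R)); exact: ua.
by under eq_fun do rewrite (fS (@complex.Im R)); exact: ub.
Qed.

Lemma has_csumE u l : has_csum u l -> csum u = l.
Proof.
move=> ul; rewrite /csum seriesEord; apply: cvg_lim ul.
exact: (@norm_hausdorff _ (R[i]^o)).
Qed.

Lemma has_csum_summable u l : has_csum u l -> csummable u.
Proof. by move=> ul; apply/cvg_ex; exists l; rewrite seriesEord; exact: ul. Qed.

Lemma has_csum_uniq u l m : has_csum u l -> has_csum u m -> l = m.
Proof. exact: clim_uniq. Qed.

Lemma eq_has_csum u v l : u =1 v -> has_csum u l -> has_csum v l.
Proof. by move=> /funext ->. Qed.

Lemma has_csumD u v l m : has_csum u l -> has_csum v m ->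
  has_csum (fun j => u j + v j) (l + m).
Proof.
move=> ul vm; have := climD ul vm; rewrite /has_csum.
by under [in X in _ -> X]eq_fun do rewrite big_split.
Qed.

Lemma has_csumZ k u l : has_csum u l -> has_csum (fun j => k * u j) (k * l).
Proof.
move=> ul; have := climZ k ul; rewrite /has_csum.
by under eq_fun do rewrite mulr_sumr.
Qed.

Arguments has_csumZ k [u l] _.

Lemma has_csum_sum (I : Type) (r : seq I) (u : I -> nat -> R[i]) (l : I -> R[i]) :
  (forall i, has_csum (u i) (l i)) ->
  has_csum (fun j => \sum_(i <- r) u i j) (\sum_(i <- r) l i).
Proof.
move=> ul; elim: r => [|i r IH].
  rewrite big_nil /has_csum; under eq_fun do under eq_bigr do rewrite big_nil.
  by under eq_fun do rewrite sumr_const mul0rn; exact: clim_cst.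
rewrite big_cons; apply: eq_has_csum (has_csumD (ul i) IH) => j.
by rewrite big_cons.
Qed.

Lemma has_csum_cons u l : has_csum (fun j => u j.+1) l <-> has_csum u (u 0%N + l).
Proof.
have E : (fun N => \sum_(j < N.+1) u j) = (fun N => u 0%N + \sum_(j < N) u j.+1).
  by apply/funext => N; rewrite big_ord_recl.
rewrite /has_csum -[X in _ <-> X]climS E; split=> [h|h].
  exact: climD (clim_cst (u 0%N)) h.
have := climD (clim_cst (- u 0%N)) h; rewrite addKr.
by under eq_fun do rewrite addKr.
Qed.

Lemma has_csum_add N u l :
  has_csum (fun j => u (N + j)%N) l <-> has_csum u (\sum_(j < N) u j + l).
Proof.
elim: N u l => [|N IH] u l; first by rewrite big_ord0 add0r.
by rewrite big_ord_recl -addrA -has_csum_cons -IH.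
Qed.

Lemma has_csum_norm_le u l b : (forall N, \sum_(j < N) `|u j| <= b) ->
  has_csum u l -> `|l| <= b.
Proof.
move=> ub; apply: clim_norm_le => N.
by rewrite (le_trans (ler_norm_sum _ _ _)).
Qed.

Lemma has_csum_finite u N : (forall j, (N <= j)%N -> u j = 0) ->
  has_csum u (\sum_(j < N) u j).
Proof.
move=> u0; rewrite -[X in has_csum _ X]addr0; apply/has_csum_add.
rewrite /has_csum; under eq_fun do under eq_bigr do rewrite u0 ?leq_addr//.
by under eq_fun do rewrite sumr_const mul0rn; exact: clim_cst.
Qed.

(** Evaluating a product of a polynomial with a power series: each factor ['X]
    shifts the series, and so multiplies its sum by [z]. *)
Lemma has_csum_conv (P : {poly R[i]}) y z l :
  has_csum (fun j => y j * z ^+ j) l ->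
  has_csum (fun j => conv P y j * z ^+ j) (P.[z] * l).
Proof.
move=> yl; elim/poly_ind: P => [|P c IH].
  rewrite horner0; apply: eq_has_csum (has_csumZ 0 yl).
  by move=> j; rewrite -polyC0 convC !mul0r.
have zP : has_csum (fun j => conv (P * 'X) y j.+1 * z ^+ j.+1) (z * (P.[z] * l)).
  apply: eq_has_csum (has_csumZ z IH) => j.
  by rewrite conv_mulX exprS mulrCA.
have := (has_csum_cons (fun j => conv (P * 'X) y j * z ^+ j) _).1 zP.
rewrite conv_mulX mul0r add0r => /has_csumD/(_ (has_csumZ c yl)).
have -> : z * (P.[z] * l) + c * l = (P * 'X + c%:P).[z] * l.
  by rewrite hornerMXaddC; ring.
by apply: eq_has_csum => j; rewrite convD convC mulrDl mulrA.
Qed.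

End ComplexSeries.
Arguments has_csumZ {R} k [u l] _.

(** * Absolutely convergent Fourier series *)

Section Fourier.
Variable R : realType.
Implicit Types (c : int -> R) (g : R -> R[i]) (w : R).

Definition fterm c w (r : int) : R[i] := (c r)%:C * expi (r%:~R * w).

(** Two-sided absolutely convergent Fourier expansions. The sums over [r >= 0]
    and over [r < 0] are kept apart, so that a shift of [c] moves a single term
    from one to the other. *)
Definition fourier c g : Prop :=
  [/\ abs_summable (fun j : nat => c j%:Z),
      abs_summable (fun j : nat => c (- j.+1%:Z))
    & forall w, exists2 l, has_csum (fun j : nat => fterm c w j%:Z) l
        & has_csum (fun j : nat => fterm c w (- j.+1%:Z)) (g w - l)].

Lemma normr_fterm c w r : `|fterm c w r| = `|c r|%:C.
Proof. by rewrite normrM normr_expi mulr1 normc_real. Qed.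

Lemma abs_summable_fterm c w (s : nat -> int) :
  abs_summable (fun j => c (s j)) -> abs_summable (fun j => fterm c w (s j)).
Proof.
move=> [M cM]; exists M%:C => N; under eq_bigr do rewrite normr_fterm.
by rewrite -rmorph_sum lecR.
Qed.

Lemma sum_symmetric (V : nmodType) (h : int -> V) N :
  \sum_(r < N.*2.+1) h (r%:Z - N%:Z)
  = \sum_(j < N.+1) h j%:Z + \sum_(j < N) h (- j.+1%:Z).
Proof.
rewrite -addnn -addnS big_split_ord /= addrC; congr (_ + _).
  by apply: eq_bigr => j _; rewrite PoszD addrAC subrr add0r.
rewrite (reindex_inj rev_ord_inj)/=; apply: eq_bigr => j _; congr h.
by rewrite -subzn// addrAC subrr add0r.
Qed.

(** A symmetric partial sum is a partial sum of each of the two halves. *)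
Lemma is_autocovP (f : R -> R) c :
  is_autocov f c <-> fourier c (fun w => (f w)%:C).
Proof.
have lim_sym w l m : has_csum (fun j : nat => fterm c w j%:Z) l ->
    has_csum (fun j : nat => fterm c w (- j.+1%:Z)) m ->
    clim (fun N => \sum_(r < N.*2.+1) fterm c w (r%:Z - N%:Z)) (l + m).
  move=> hl hm; under eq_fun do rewrite sum_symmetric.
  exact: (climD (proj2 (climS _ _) hl) hm).
split=> [[cc cf]|[c1 c2 cf]].
  have [M cM] : abs_summable (fun r : nat => `|c r| + `|c (- r%:Z)|).
    apply/abs_summableP; under eq_fun do rewrite ger0_norm ?addr_ge0//.
    exact: cc.
  have c1 : abs_summable (fun j : nat => c j%:Z).
    exists M => N; rewrite (le_trans _ (cM N))// ler_sum// => j _.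
    by rewrite [leRHS]ger0_norm ?addr_ge0// lerDl.
  have c2 : abs_summable (fun j : nat => c (- j.+1%:Z)).
    apply/(abs_summableS (fun j : nat => c (- j%:Z))).
    exists M => N; rewrite (le_trans _ (cM N))// ler_sum// => j _.
    by rewrite [leRHS]ger0_norm ?addr_ge0// lerDr.
  split=> // w.
  have [l hl] := has_csum_exists (abs_summable_fterm w c1).
  have [m hm] := has_csum_exists (abs_summable_fterm w c2).
  exists l => //; suff -> : (f w)%:C - l = m by [].
  apply/eqP; rewrite subr_eq addrC; apply/eqP.
  exact: clim_uniq (cf w) (lim_sym _ _ _ hl hm).
split=> [|w]; last first.
  by have [l hl hm] := cf w; have := lim_sym _ _ _ hl hm; rewrite subrKC.
have : abs_summable (fun r : nat => `|c r| + `|c (- r%:Z)|).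
  apply: abs_summableD.
    by case: c1 => M cM; exists M => N; under eq_bigr do rewrite normr_id.
  apply/abs_summableS.
  by case: c2 => M cM; exists M => N; under eq_bigr do rewrite normr_id.
move/abs_summableP; under eq_fun do rewrite ger0_norm ?addr_ge0//.
exact.
Qed.

Lemma eq_fourier c d g h : c =1 d -> g =1 h -> fourier c g -> fourier d h.
Proof. by move=> /funext -> /funext ->. Qed.

Lemma fourierD c d g h : fourier c g -> fourier d h ->
  fourier (fun r => c r + d r) (fun w => g w + h w).
Proof.
move=> [c1 c2 cg] [d1 d2 dh]; split; [exact: abs_summableD..|move=> w].
have [l hl hg] := cg w; have [m hm hh] := dh w.
exists (l + m).
  by apply: eq_has_csum (has_csumD hl hm) => j; rewrite /fterm rmorphD mulrDl.
rewrite opprD addrACA.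
by apply: eq_has_csum (has_csumD hg hh) => j; rewrite /fterm rmorphD mulrDl.
Qed.

Lemma fourierZ k c g : fourier c g ->
  fourier (fun r => k * c r) (fun w => k%:C * g w).
Proof.
move=> [c1 c2 cg]; split; [exact: abs_summableZ..|move=> w].
have [l hl hg] := cg w; exists (k%:C * l).
  by apply: eq_has_csum (has_csumZ k%:C hl) => j; rewrite /fterm rmorphM mulrA.
rewrite -mulrBr.
by apply: eq_has_csum (has_csumZ k%:C hg) => j; rewrite /fterm rmorphM mulrA.
Qed.

Lemma fourier0 : fourier (fun=> 0) (fun=> 0).
Proof.
have s0 : abs_summable (fun _ : nat => 0 : R) by exact: (@abs_summable_finite _ _ 0).
have h0 w (s : nat -> int) : has_csum (fun j => fterm (fun=> 0) w (s j)) 0.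
  have := @has_csum_finite R (fun j => fterm (fun=> 0) w (s j)) 0.
  by rewrite big_ord0; apply => j _; rewrite /fterm mul0r.
by split=> // w; exists 0; rewrite ?subr0; exact: h0.
Qed.

Lemma fourier_sum (I : Type) (r : seq I) (c : I -> int -> R) (g : I -> R -> R[i]) :
  (forall i, fourier (c i) (g i)) ->
  fourier (fun k => \sum_(i <- r) c i k) (fun w => \sum_(i <- r) g i w).
Proof.
move=> cg; elim: r => [|i r IH].
  by apply: eq_fourier fourier0 => ?; rewrite big_nil.
by apply: eq_fourier (fourierD (cg i) IH) => ?; rewrite big_cons.
Qed.

Lemma fourier_shift1 c g : fourier c g ->
  fourier (fun r => c (r - 1)) (fun w => expi w * g w).
Proof.
move=> [c1 c2 cg]; split=> [||w].
- apply/abs_summableS; apply: eq_abs_summable c1 => j.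
  by congr c; lia.
- by move/(abs_summableS (fun j : nat => c (- j.+1%:Z))) : c2; apply: eq_abs_summable => j; congr c; lia.
have e1 r : fterm (fun r => c (r - 1)) w r = expi w * fterm c w (r - 1).
  rewrite /fterm mulrCA -expiD; congr (_ * expi _).
  by rewrite rmorphB/= mulrBl mul1r subrKC.
have [l hl hg] := cg w.
exists (expi w * (fterm c w (- 1) + l)).
  rewrite mulrDr.
  have := @has_csum_cons R (fun j : nat => fterm (fun r => c (r - 1)) w j%:Z) (expi w * l).
  rewrite e1 => -[+ _]; apply; apply: eq_has_csum (has_csumZ (expi w) hl) => j.
  by rewrite e1; congr (_ * fterm _ _ _); lia.
have -> : expi w * g w - expi w * (fterm c w (-1) + l)
    = expi w * (- fterm c w (- 1) + (g w - l)) by ring.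
have : has_csum (fun j : nat => fterm c w (- j.+2%:Z)) (- fterm c w (- 1) + (g w - l)).
  apply/(has_csum_cons (fun j : nat => fterm c w (- j.+1%:Z))).
  by rewrite addNKr.
move=> /(has_csumZ (expi w)); apply: eq_has_csum => j.
by rewrite e1; congr (_ * fterm _ _ _); lia.
Qed.

Lemma fourier_refl c g : fourier c g ->
  fourier (fun r => c (- r)) (fun w => g (- w)).
Proof.
move=> [c1 c2 cg]; split=> [||w].
- by apply/abs_summableS.
- by move/(abs_summableS (fun j : nat => c j%:Z)) : c1; apply: eq_abs_summable => j; rewrite opprK.
have e1 r : fterm (fun r => c (- r)) w r = fterm c (- w) (- r).
  by rewrite /fterm rmorphN/= mulrNN.
have [l hl hg] := cg (- w).
exists (fterm c (- w) 0 + (g (- w) - l)).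
  have := @has_csum_cons R (fun j : nat => fterm (fun r => c (- r)) w j%:Z) (g (- w) - l).
  rewrite e1 oppr0 => -[+ _]; apply; apply: eq_has_csum hg => j.
  by rewrite e1.
have -> : g (- w) - (fterm c (- w) 0 + (g (- w) - l)) = - fterm c (- w) 0 + l by ring.
have : has_csum (fun j : nat => fterm c (- w) j.+1%:Z) (- fterm c (- w) 0 + l).
  apply/(has_csum_cons (fun j : nat => fterm c (- w) j%:Z)).
  by rewrite addNKr.
by apply: eq_has_csum => j; rewrite e1 opprK.
Qed.

(** Negative shifts reduce to positive ones by reflection. *)
Lemma fourier_shift (k : int) c g : fourier c g ->
  fourier (fun r => c (r - k)) (fun w => expi (k%:~R * w) * g w).
Proof.
have shiftN n d h : fourier d h ->
    fourier (fun r => d (r - n%:Z)) (fun w => expi (n%:R * w) * h w).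
  move=> dh; elim: n => [|n IH].
    by apply: eq_fourier dh => [r|w]; rewrite ?subr0// mul0r expi0 mul1r.
  apply: eq_fourier (fourier_shift1 IH) => [r|w]; first by congr d; lia.
  by rewrite mulrA -expiD -nat1r mulrDl mul1r.
move=> cg; case: k => n; first exact: shiftN.
have := fourier_refl (shiftN n.+1 _ _ (fourier_refl cg)).
apply: eq_fourier => [r|w]; first by congr c; lia.
by rewrite opprK NegzE rmorphN/= mulNr mulrN.
Qed.

Lemma fourier_onesided (y : nat -> R) g : abs_summable y ->
  (forall w, has_csum (fun j => (y j)%:C * expi w ^+ j) (g w)) ->
  fourier (fun r => if r is Posz j then y j else 0) g.
Proof.
move=> ys yg; split=> [//||w].
  by apply: (@abs_summable_finite _ _ 0) => j _; rewrite -NegzE.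
exists (g w); first by apply: eq_has_csum (yg w) => j; rewrite /fterm expiMn.
have := @has_csum_finite R (fun j => fterm (fun r => if r is Posz j then y j else 0) w (- j.+1%:Z)) 0.
by rewrite big_ord0 subrr; apply => j _; rewrite -NegzE /fterm mul0r.
Qed.

(** Averaging over the [N]-th roots of unity keeps, of the frequencies below
    [N], the zero frequency only; the others are dominated by the tails. *)
Lemma fourier_mean c g (e : R) : fourier c g -> 0 < e ->
  exists2 N, (0 < N)%N &
    `|(N%:R)^-1 * (\sum_(k < N) g (omega R N k)) - (c 0)%:C| <= e%:C.
Proof.
move=> [c1 c2 cg] e0; have e20 : 0 < e / 2 by rewrite divr_gt0.
have [M1 hM1] := abs_summable_tail (proj2 (abs_summableS _) c1) e20.
have [M2 hM2] := abs_summable_tail c2 e20.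
pose N := (M1 + M2).+1; exists N => //.
have N0 : (N%:R : R[i]) != 0 by rewrite pnatr_eq0.
pose head w := (c 0)%:C + (\sum_(j < M1) fterm c w j.+1%:Z
  + \sum_(j < M2) fterm c w (- j.+1%:Z)).
have gE w : `|g w - head w| <= e%:C.
  have [l hl hm] := cg w.
  have := (has_csum_cons (fun j : nat => fterm c w j%:Z) (l - fterm c w 0)).2.
  rewrite subrKC => /(_ hl)/= hl1.
  have := (has_csum_add M1 (fun j : nat => fterm c w j.+1%:Z)
    (l - fterm c w 0 - \sum_(j < M1) fterm c w j.+1%:Z)).2.
  rewrite subrKC => /(_ hl1)/= hl2.
  have := (has_csum_add M2 (fun j : nat => fterm c w (- j.+1%:Z))
    (g w - l - \sum_(j < M2) fterm c w (- j.+1%:Z))).2.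
  rewrite subrKC => /(_ hm)/= hm2.
  have -> : g w - head w = (l - fterm c w 0 - \sum_(j < M1) fterm c w j.+1%:Z)
      + (g w - l - \sum_(j < M2) fterm c w (- j.+1%:Z)).
    by rewrite /head /fterm mul0r expi0 mulr1; ring.
  rewrite [e]splitr rmorphD/= (le_trans (ler_normD _ _))// lerD//.
    apply: has_csum_norm_le hl2 => m; under eq_bigr do rewrite normr_fterm.
    by rewrite -rmorph_sum lecR.
  apply: has_csum_norm_le hm2 => m; under eq_bigr do rewrite normr_fterm.
  by rewrite -rmorph_sum lecR.
have sum0 (r : int) : (0 < `|r| < N)%N -> \sum_(k < N) fterm c (omega R N k) r = 0.
  move=> rN; rewrite -mulr_sumr sum_expi_omega// ifF ?mulr0//.
  by apply/negbTE; rewrite dvdzE/= gtnNdvd//; case/andP: rN.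
have sum_head : \sum_(k < N) head (omega R N k) = N%:R * (c 0)%:C.
  rewrite big_split /= sumr_const card_ord -[RHS]addr0 mulr_natl; congr (_ + _).
  rewrite big_split /= exchange_big /= big1 ?add0r => [|j _]; last first.
    by rewrite sum0//= ltnS (leq_trans (ltn_ord j))// leq_addr.
  rewrite exchange_big /= big1// => j _.
  by rewrite sum0//= ltnS (leq_trans (ltn_ord j))// leq_addl.
have -> : (N%:R)^-1 * (\sum_(k < N) g (omega R N k)) - (c 0)%:C
    = (N%:R)^-1 * \sum_(k < N) (g (omega R N k) - head (omega R N k)).
  by rewrite sumrB sum_head mulrBr mulKf.
rewrite normrM normfV normr_nat ler_pdivrMl ?ltr0n// mulr_natl.
rewrite (le_trans (ler_norm_sum _ _ _))//.
have -> : e%:C *+ N = \sum_(k < N) e%:C by rewrite sumr_const card_ord.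
by apply: ler_sum => k _; exact: gE.
Qed.

(** A shift brings any frequency of [c - d] to frequency zero, where its
    coefficient is a limit of averages of the zero function. *)
Lemma fourier_uniq c d g : fourier c g -> fourier d g -> c =1 d.
Proof.
move=> cg dg r.
have := fourier_shift (- r) (fourierD cg (fourierZ (- 1) dg)).
move=> /fourier_mean h; apply/eqP; rewrite -subr_eq0 -normr_eq0.
rewrite eq_le normr_ge0 andbT; apply/ler_addgt0Pl => e e0.
have [N N0] := h _ e0.
have gg0 (x : R[i]) : x + (- 1)%:C * x = 0 by rewrite rmorphN rmorph1 mulN1r subrr.
under eq_bigr do rewrite gg0 mulr0.
by rewrite sumr_const mul0rn mulr0 sub0r normrN normc_real lecR opprK add0r mulN1r addr0.
Qed.

(** The zero frequency is a limit of averages of [g]. *)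
Lemma fourier_ge0 c g : fourier c g -> (forall w, 0 <= g w) -> 0 <= c 0.
Proof.
move=> cg g0; apply/ler_addgt0Pl => e e0.
have [N N0 h] := fourier_mean cg e0.
have m0 : 0 <= (N%:R)^-1 * (\sum_(k < N) g (omega R N k)).
  by rewrite mulr_ge0 ?invr_ge0// sumr_ge0.
rewrite -ler0c rmorphD/=.
apply: (le_trans m0); rewrite -lerBlDr; apply: le_trans h.
apply: real_ler_norm; apply: realB; first exact: ger0_real.
by rewrite realE -[0]/(0%:C) !lecR le_total.
Qed.

End Fourier.

(** Multiplication by a trigonometric polynomial acts on Fourier coefficients
    as a linear filter. *)
Lemma fourier_horner (R : realType) (P : {poly R}) N (c : int -> R) g :
  (size P <= N)%N -> fourier c g ->
  fourier (fun r => \sum_(i < N) P`_i * c (r - i%:Z))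
          (fun w => (map_poly (real_complex R) P).[expi w] * g w).
Proof.
move=> PN cg.
have := fourier_sum (index_enum 'I_N) (fun i : 'I_N => fourierZ P`_i (fourier_shift i%:Z cg)).
apply: eq_fourier => // w.
rewrite (@horner_coef_wide _ N) ?size_map_poly// mulr_suml.
by apply: eq_bigr => i _; rewrite coef_map/= -mulrA expiMn.
Qed.

Lemma fourier_delta (R : realType) :
  fourier (fun r : int => (r == 0)%:R : R) (fun=> 1 : R[i]).
Proof.
have ys : abs_summable (fun j => (j == 0%N)%:R : R).
  by apply: (@abs_summable_finite _ _ 1) => -[].
have yF : fourier (fun r => if r is Posz j then (j == 0%N)%:R else 0 : R) (fun=> 1 : R[i]).
  apply: (fourier_onesided ys) => w.
  have := @has_csum_finite R (fun j => (j == 0%N)%:R%:C * expi w ^+ j) 1.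
  rewrite big_ord1 expr0 mulr1; apply => -[|j] // _.
  by rewrite mul0r.
by apply: (eq_fourier _ _ yF) => // -[].
Qed.

Lemma sum_expi_quad (R : realType) n (x : 'I_n -> R) w (F : R[i]) :
  \sum_s \sum_t (x s * x t)%:C * (expi ((t%:Z - s%:Z)%:~R * w) * F)
  = F * `|\sum_s (x s)%:C * expi (s%:R * w)| ^+ 2.
Proof.
have conj_term s : ((x s)%:C * expi (s%:R * w))^* = (x s)%:C * expi (- (s%:R * w)).
  by rewrite rmorphM [X in X * _]conjc_real [X in _ * X]conj_expi.
rewrite sqr_normc [X in _ * X]mulrC rmorph_sum big_distrlr mulr_sumr.
apply: eq_bigr => s _; rewrite mulr_sumr; apply: eq_bigr => t _.
rewrite [X in _ = _ * (X * _)]conj_term.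
have -> : (t%:Z - s%:Z)%:~R * w = - (s%:R * w) + t%:R * w.
  by rewrite rmorphB/= mulrBl addrC.
rewrite expiD rmorphM [RHS]mulrC [X in _ = X * _]mulrACA.
by rewrite -[RHS]mulrA.
Qed.

(** * Causal autoregressive spectral densities *)

Lemma addf_bezout (F : fieldType) (A B z a b : F) : a != 0 -> b != 0 ->
  A * b + B * (z * a) = 1 -> A * a^-1 + z * (B * b^-1) = (a * b)^-1.
Proof.
by move=> a0 b0 AB; rewrite -[RHS]mul1r -AB; field; rewrite a0 b0.
Qed.

Section AR.
Variables (R : realType) (p : nat) (phi : nat -> R).
Hypothesis causal : forall z : R[i], root (ar_charpoly p phi) z -> 1 < `|z|.

Local Notation toC := (map_poly (real_complex R)).

(** [ar_charpoly] before its embedding in [{poly R[i]}], for the weights and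
    the autocovariances, which are real. *)
Definition arpoly : {poly R} := \poly_(u < p.+1) ar_tilde p phi u%:Z.

Lemma coef_arpoly u : arpoly`_u = ar_tilde p phi u%:Z.
Proof.
rewrite coef_poly ltnS /=; case: leqP => // pu.
by rewrite gtn_eqF// (leq_trans _ pu).
Qed.

Lemma map_arpoly : toC arpoly = ar_charpoly p phi.
Proof.
apply/polyP => i; rewrite coef_map coef_arpoly /ar_charpoly coefB coef1 coef_sum /=.
under eq_bigr do rewrite coefZ coefXn.
have [->|i0] := eqVneq i 0%N.
  rewrite big_nat_cond big1 ?subr0// => u; rewrite andbT => /andP[u0 _].
  by rewrite ltn_eqF ?mulr0.
rewrite sub0r; case: leqP => [ip|pi].
  rewrite (bigD1_seq i) ?iota_uniq ?mem_index_iota ?lt0n ?i0//= eqxx mulr1.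
  rewrite big1 ?addr0 ?rmorphN// => u ui.
  by rewrite eq_sym (negPf ui) mulr0.
rewrite big_nat_cond big1 ?oppr0// => u; rewrite andbT => /andP[_ up].
by rewrite gtn_eqF ?mulr0// (leq_trans up).
Qed.

Lemma horner_charpoly (z : R[i]) :
  (ar_charpoly p phi).[z] = 1 - \sum_(1 <= u < p.+1) (phi u)%:C * z ^+ u.
Proof.
rewrite /ar_charpoly hornerD hornerN horner_sum hornerC.
by under eq_bigr do rewrite hornerZ hornerXn.
Qed.

(** Conjugation of [ar_fun p phi w] amounts to changing the sign of [w]; below,
    [ar_fun p phi (- w)] stands for the conjugate, so that both are values of
    one polynomial. *)
Lemma ar_funE w : ar_fun p phi w = (ar_charpoly p phi).[expi (- w)].
Proof.
rewrite horner_charpoly; congr (_ - _); apply: eq_bigr => u _.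
by rewrite -expiMn mulrN.
Qed.

Lemma ar_funNE w : ar_fun p phi (- w) = (ar_charpoly p phi).[expi w].
Proof. by rewrite ar_funE opprK. Qed.

Lemma conj_ar_fun w : (ar_fun p phi w)^* = ar_fun p phi (- w).
Proof.
rewrite /ar_fun rmorphB rmorph1 rmorph_sum; congr (_ - _).
apply: eq_bigr => u _.
by rewrite rmorphM [X in X * _]conjc_real [X in _ * X]conj_expi mulrN.
Qed.

Lemma ar_fun_neq0 w : ar_fun p phi w != 0.
Proof.
apply/negP => /eqP; rewrite ar_funE => /rootP/causal.
by rewrite normr_expi ltxx.
Qed.

Lemma ar_densityE sigma w :
  (ar_density sigma p phi w)%:C
  = (sigma ^+ 2)%:C / (ar_fun p phi w * ar_fun p phi (- w)).
Proof.
rewrite -conj_ar_fun -sqr_normc /ar_density rmorphM; congr (_ * _).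
by rewrite fmorphV rmorphXn.
Qed.

Lemma conv_arpoly_toC (y : nat -> R) j :
  (conv arpoly y j)%:C = conv (ar_charpoly p phi) (fun j => (y j)%:C) j.
Proof.
rewrite rmorph_sum -map_arpoly; apply: eq_bigr => u _.
by rewrite coef_map rmorphM.
Qed.

Lemma abs_summable_ar (y : nat -> R) :
  abs_summable (conv arpoly y) -> abs_summable y.
Proof.
move=> ys; apply/abs_summable_toC/(abs_summable_deconv causal).
by move/abs_summable_toC : ys; apply: eq_abs_summable => j; exact: conv_arpoly_toC.
Qed.

(** Summing a solution of the AR recursion with finite input: the recursion
    becomes division by the transfer function. *)
Lemma has_csum_ar (y g : nat -> R) N w :
  (forall j, conv arpoly y j = g j) -> (forall j, (N <= j)%N -> g j = 0) ->
  has_csum (fun j => (y j)%:C * expi w ^+ j)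
    ((ar_fun p phi (- w))^-1 * \sum_(j < N) (g j)%:C * expi w ^+ j).
Proof.
move=> yg g0.
have ys : abs_summable y.
  by apply: abs_summable_ar; apply: (@abs_summable_finite _ _ N) => j /g0; rewrite yg.
have [l yl] : exists l, has_csum (fun j => (y j)%:C * expi w ^+ j) l.
  apply: has_csum_exists; move/abs_summable_toC : ys.
  by apply: abs_summable_le => j; rewrite normrM normrX normr_expi expr1n mulr1.
have gl : has_csum (fun j => (g j)%:C * expi w ^+ j) ((ar_charpoly p phi).[expi w] * l).
  apply: eq_has_csum (has_csum_conv (P := ar_charpoly p phi) yl) => j.
  by rewrite -conv_arpoly_toC yg.
rewrite (has_csum_uniq (has_csum_finite _) gl); last by move=> j /g0 ->; rewrite mul0r.
by rewrite -ar_funNE mulKf ?ar_fun_neq0.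
Qed.

Definition ar_reversed : {poly R} := rev_poly p arpoly.

Lemma horner_ar_reversed (z : R[i]) : z != 0 ->
  (toC ar_reversed).[z] = z ^+ p * (ar_charpoly p phi).[z^-1].
Proof.
move=> z0; rewrite map_rev_poly map_arpoly horner_rev_poly//.
by rewrite -map_arpoly size_map_poly size_poly.
Qed.

(** The roots of [phi] lie outside the unit disc, and those of its reciprocal,
    which are their inverses or [0], inside. *)
Lemma coprime_ar_reversed : coprimep arpoly ar_reversed.
Proof.
rewrite -(coprimep_map (real_complex R)); apply: Pdiv.ClosedField.root_coprimep => z.
rewrite map_arpoly => /[dup] rz /causal z1; apply/negP => /eqP.
have z0 : z != 0 by rewrite -normr_gt0 (lt_trans _ z1).
rewrite horner_ar_reversed// => /eqP; rewrite mulf_eq0 expf_eq0 (negPf z0) andbF/=.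
move=> /causal; rewrite normfV invf_gt1 ?normr_gt0// => /(lt_trans z1).
by rewrite ltxx.
Qed.

Lemma fourier_ar_inv : exists psi : nat -> R,
  fourier (fun r => if r is Posz j then psi j else 0) (fun w => (ar_fun p phi (- w))^-1).
Proof.
have [psi psiE] : exists psi : nat -> R, forall j, conv arpoly psi j = (j == 0%N)%:R.
  by apply: conv_surj; rewrite coef_arpoly.
exists psi; apply: fourier_onesided => [|w].
  by apply: abs_summable_ar; apply: (@abs_summable_finite _ _ 1) => -[|j]//; rewrite psiE.
have := @has_csum_ar psi (fun j => (j == 0%N)%:R) 1 w psiE.
by rewrite big_ord1 expr0 !mulr1; apply => -[].
Qed.

(** By Bezout, [1 / (phi(z) phi(1/z)) = A(z) / phi(1/z) + z^p B(z) / phi(z)]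
    on the unit circle: a combination of two one-sided series. *)
Lemma ar_density_autocov sigma : exists c, is_autocov (ar_density sigma p phi) c.
Proof.
have [psi psiF] := fourier_ar_inv.
have /Bezout_eq1_coprimepP[[A B]/= AB] := coprime_ar_reversed.
have := fourierZ (sigma ^+ 2) (fourierD (fourier_horner (leqnn (size A)) (fourier_refl psiF))
  (fourier_shift p%:Z (fourier_horner (leqnn (size B)) psiF))).
move=> F; have gE w : (sigma ^+ 2)%:C
    * ((toC A).[expi w] * (ar_fun p phi (- - w))^-1
       + expi (p%:Z%:~R * w) * ((toC B).[expi w] * (ar_fun p phi (- w))^-1))
    = (ar_density sigma p phi w)%:C; last first.
  by eexists; apply/is_autocovP; exact: eq_fourier (fun=> erefl) gE F.
have ABw : (toC A).[expi w] * ar_fun p phi (- w)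
    + (toC B).[expi w] * (expi w ^+ p * ar_fun p phi w) = 1.
  rewrite (ar_funNE w) (ar_funE w) expiN -(horner_ar_reversed (expi_neq0 w)) -map_arpoly.
  by rewrite -!hornerM -hornerD -!rmorphM -rmorphD AB rmorph1 hornerC.
rewrite opprK ar_densityE expiMn; congr (_ * _).
exact: (addf_bezout (ar_fun_neq0 w) (ar_fun_neq0 (- w)) ABw).
Qed.

Lemma ar_densityN sigma w : ar_density sigma p phi (- w) = ar_density sigma p phi w.
Proof.
apply/eqP; rewrite -(inj_eq (@complexI R)) !ar_densityE; apply/eqP; congr (_ / _).
by rewrite opprK mulrC.
Qed.

(** [|phi|] is at most the sum of the moduli of the coefficients. *)
Lemma ar_density_ge sigma : 0 < sigma ^+ 2 ->
  exists2 m, 0 < m & forall w, m <= ar_density sigma p phi w.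
Proof.
move=> s0; pose B : R := 1 + \sum_(1 <= u < p.+1) `|phi u|.
have B0 : 0 < B by rewrite ltr_wpDr ?sumr_ge0.
exists (sigma ^+ 2 * B ^- 2) => [|w]; first by rewrite mulr_gt0// invr_gt0 exprn_gt0.
have aR : (complex.Re `|ar_fun p phi w|)%:C = `|ar_fun p phi w| by rewrite RRe_real ?normr_real.
have a0 : 0 < complex.Re `|ar_fun p phi w| by rewrite -ltcR aR normr_gt0 ar_fun_neq0.
rewrite ler_pM2l// lef_pV2 ?posrE ?exprn_gt0// ler_pXn2r ?nnegrE ?(ltW a0) ?(ltW B0)//.
rewrite -lecR aR rmorphD rmorph1 rmorph_sum (le_trans (ler_normB _ _))// normr1 lerD2l.
rewrite (le_trans (ler_norm_sum _ _ _))// ler_sum// => u _.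
by rewrite normrM normr_expi mulr1 normc_real.
Qed.

Section Autocovariance.
Variables (sigma : R) (c : int -> R).
Hypothesis sigma2_gt0 : 0 < sigma ^+ 2.
Hypothesis cf : fourier c (fun w => (ar_density sigma p phi w)%:C).

Lemma ar_autocovN r : c (- r) = c r.
Proof.
have cNf : fourier (fun r => c (- r)) (fun w => (ar_density sigma p phi w)%:C).
  by apply: eq_fourier (fourier_refl cf) => // w; rewrite ar_densityN.
exact: (fourier_uniq cNf cf r).
Qed.

(** The left side is the coefficient at frequency [r] of
    [phi(e^{iw}) f(w) = sigma^2 / phi(e^{-iw})], a series in [e^{-iw}]. *)
Lemma yule_walker N r : (p <= N)%N -> 0 < r ->
  \sum_(u < N.+1) arpoly`_u * c (r - u%:Z) = 0.
Proof.
move=> pN r0; have [psi psiF] := fourier_ar_inv.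
have sP : (size arpoly <= N.+1)%N by rewrite (leq_trans (size_poly _ _)).
have := fourierZ (sigma ^+ 2) (fourier_refl psiF).
have gE w : (toC arpoly).[expi w] * (ar_density sigma p phi w)%:C
    = (sigma ^+ 2)%:C * (ar_fun p phi (- - w))^-1.
  rewrite map_arpoly -ar_funNE ar_densityE opprK invfM [_^-1 * _]mulrC.
  by rewrite mulrCA mulVKf ?ar_fun_neq0.
move/(fourier_uniq (eq_fourier (fun=> erefl) gE (fourier_horner sP cf)))=> ->.
by case: r r0 => [[|r]|r]//; rewrite -NegzE mulr0.
Qed.

(** With [f >= m > 0], the quadratic form minus [m |x|^2] is the zero frequency
    of the nonnegative function [(f - m) |sum_s x_s e^{isw}|^2]. *)
Lemma ar_autocov_posdef n (x : 'I_n -> R) i : x i != 0 ->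
  0 < \sum_s \sum_t x s * x t * c (s%:Z - t%:Z).
Proof.
move=> xi; have [m m0 mf] := ar_density_ge sigma2_gt0.
have d0F := fourier_delta R.
have cmF := fourierD cf (fourierZ (- m) d0F).
have := fourier_sum (index_enum 'I_n) (fun s : 'I_n => fourier_sum (index_enum 'I_n)
  (fun t : 'I_n => fourierZ (x s * x t) (fourier_shift (t%:Z - s%:Z) cmF))).
move=> F; have gE w := sum_expi_quad x w ((ar_density sigma p phi w)%:C + (- m)%:C * 1).
have := fourier_ge0 (eq_fourier (fun=> erefl) gE F).
have g0 w : 0 <= ((ar_density sigma p phi w)%:C + (- m)%:C * 1)
    * `|\sum_s (x s)%:C * expi (s%:R * w)| ^+ 2.
  by rewrite mulr_ge0 ?exprn_ge0// mulr1 -rmorphD ler0c subr_ge0.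
move=> /(_ g0) h.
have {}h : 0 <= \sum_s \sum_t x s * x t * (c (s%:Z - t%:Z) - m * (s == t)%:R).
  congr (0 <= _) : h.
  apply: eq_bigr => s _; apply: eq_bigr => t _; congr (_ * (_ + _)).
    by congr c; rewrite sub0r opprB.
  by rewrite mulNr sub0r oppr_eq0 subr_eq0 eq_sym.
have xx : 0 < \sum_s x s ^+ 2.
  rewrite (bigD1 i)//= ltr_wpDr ?sumr_ge0// => [j _|]; first exact: sqr_ge0.
  by rewrite exprn_even_gt0.
apply: lt_le_trans (mulr_gt0 m0 xx) _; rewrite -subr_ge0.
congr (0 <= _) : h.
rewrite mulr_sumr -sumrB; apply: eq_bigr => s _.
under eq_bigr do rewrite mulrBr.
rewrite sumrB; congr (_ - _).
rewrite (bigD1 s)//= eqxx mulr1 big1 ?addr0 => [|t ts]; last first.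
  by rewrite eq_sym (negPf ts) !mulr0.
by rewrite mulrC expr2.
Qed.

End Autocovariance.

End AR.

(** * Best linear prediction *)

Section BestPredictor.
Variables (R : realType) (n : nat) (c : int -> R).
Hypothesis cN : forall r, c (- r) = c r.
Hypothesis c_posdef : forall (x : 'I_n -> R) i, x i != 0 ->
  0 < \sum_s \sum_t x s * x t * c (s%:Z - t%:Z).

Let G : 'M[R]_n := \matrix_(s, t) c (s%:Z - t%:Z).
Let quad (a b : 'rV[R]_n) : R := (a *m G *m b^T) 0 0.

Let quadE a b : quad a b = \sum_s \sum_t a 0 s * b 0 t * c (s%:Z - t%:Z).
Proof.
rewrite /quad mxE exchange_big; apply: eq_bigr => t _.
rewrite mxE mulr_suml; apply: eq_bigr => s _.
by rewrite !mxE mulrAC.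
Qed.

Let quadC a b : quad a b = quad b a.
Proof.
rewrite !quadE exchange_big; apply: eq_bigr => t _; apply: eq_bigr => s _.
by rewrite -cN opprB [a 0 s * _]mulrC.
Qed.

Let quad_gt0 a : a != 0 -> 0 < quad a a.
Proof.
move=> /rV0Pn[i ai]; rewrite quadE.
exact: (@c_posdef (fun t => a 0 t) i).
Qed.

(** Completing the square: [mse b - mse a = (b - a) G (b - a)^T] when [a]
    solves the normal equations. *)
Lemma best_pred_unique tau (a : 'rV[R]_n) :
  (forall k : 'I_n, \sum_t a 0 t * c (t%:Z - k%:Z) = c (tau - k.+1%:Z)) ->
  [set b | is_best_pred c tau b] = [set a].
Proof.
move=> normal_eq.
have mseE b : pred_mse c tau b = c 0 - 2 * quad a b + quad b b.
  rewrite /pred_mse quadE; congr (_ - 2 * _ + _).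
    rewrite exchange_big; apply: eq_bigr => k _ /=.
    by rewrite -normal_eq mulr_sumr; apply: eq_bigr => t _; rewrite mulrA [b 0 k * _]mulrC.
  rewrite quadE; apply: eq_bigr => s _; apply: eq_bigr => t _.
  by congr (_ * c _); lia.
have gapE b : pred_mse c tau b = pred_mse c tau a + quad (b - a) (b - a).
  have : quad (b - a) (b - a) = quad b b - quad a b - quad a b + quad a a.
    rewrite -[X in _ - X + _]quadC /quad linearB/= !mulmxBl !mulmxBr.
    by rewrite !(mxE, opprB, opprD) /=; ring.
  by rewrite !mseE => ->; ring.
apply/seteqP; split=> [b bbest|_ -> b]; last first.
  rewrite (gapE b) lerDl; have [->|/quad_gt0/ltW//] := eqVneq (b - a) 0.
  by rewrite /quad !mul0mx mxE.
apply/eqP; rewrite -subr_eq0; apply: contraT => /quad_gt0.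
by have := bbest a; rewrite (gapE b) gerDl leNgt => /negPf ->.
Qed.

End BestPredictor.

Section ARPrediction.
Variables (R : realType) (p : nat) (phi : nat -> R) (sigma : R) (n : nat).
Hypothesis causal : forall z : R[i], root (ar_charpoly p phi) z -> 1 < `|z|.
Hypothesis sigma2_gt0 : 0 < sigma ^+ 2.
Hypothesis le_pn : (p <= n)%N.

Local Notation f := (ar_density sigma p phi).
Local Notation c := (autocov f).
Local Notation arpoly := (arpoly p phi).

Lemma autocovP : is_autocov f c.
Proof. exact: xgetPex (ar_density_autocov causal sigma). Qed.

Let cf : fourier c (fun w => (f w)%:C) := (is_autocovP _ _).1 autocovP.
Let cN := ar_autocovN cf.

(** [A l j] is to be the weight of [X_(n+1-l)] in the prediction of [X_(n+1+j)]:
    as a sequence in [j], the response of the AR recursion to a unit value at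
    time [n + 1 - l]. *)
Lemma ar_weight_exists : exists A : nat -> nat -> R,
  forall l j, conv arpoly (A l) j = - arpoly`_(l + j).
Proof.
have P0 : arpoly`_0 = 1 by rewrite coef_arpoly.
have [A hA] := choice (fun l => conv_surj (fun j => - arpoly`_(l + j)) P0).
by exists A.
Qed.

Variable A : nat -> nat -> R.
Hypothesis convA : forall l j, conv arpoly (A l) j = - arpoly`_(l + j).

(** As sequences in [j], both sides have the same product with [phi]: on the
    left by the recursion for the weights, on the right by the Yule-Walker
    equations, whose terms of index above [j] reach back into the sample. *)
Lemma ar_weight_normal k j : (0 < k)%N ->
  \sum_(l < n) A l.+1 j * c (l.+1%:Z - k%:Z) = c (j%:Z + k%:Z).
Proof.
move=> k0; move: j; apply: (@conv_inj _ arpoly).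
  by rewrite coef_arpoly.
move=> j; rewrite /conv.
under eq_bigr do rewrite mulr_sumr.
rewrite exchange_big /=.
have -> : \sum_(l < n) \sum_(u < j.+1) arpoly`_u * (A l.+1 (j - u)%N * c (l.+1%:Z - k%:Z))
    = - \sum_(l < n) arpoly`_(j.+1 + l) * c (j%:Z + k%:Z - (j.+1 + l)%N%:Z).
  rewrite -sumrN; apply: eq_bigr => l _.
  under eq_bigr do rewrite mulrA.
  rewrite -mulr_suml -/(conv arpoly (A l.+1) j) convA -mulNr addSnnS [(l + _)%N]addnC.
  by rewrite -cN; congr (_ * c _); lia.
have := @yule_walker _ _ _ causal _ _ cf (j + n) (j%:Z + k%:Z) (leq_trans le_pn (leq_addl _ _)).
rewrite -addSn big_split_ord /= => H.
apply/esym/eqP; rewrite -addr_eq0 -[X in _ == X]H; last by lia.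
rewrite -subr_eq0 opprD addrACA subrr addr0 -sumrB big1// => u _.
by rewrite -mulrBr (_ : c _ = c (j%:Z + k%:Z - u%:Z)) ?subrr ?mulr0//; congr c; have := ltn_ord u; lia.
Qed.

Lemma ar_weight_normal_left j (k : 'I_n) :
  \sum_(t < n) A t.+1 j * c (t%:Z - k%:Z) = c (- j%:Z - k.+1%:Z).
Proof.
rewrite -cN (_ : - (- j%:Z - k.+1%:Z) = j%:Z + k.+1%:Z); last by lia.
rewrite -ar_weight_normal//; apply: eq_bigr => l _.
by congr (_ * c _); lia.
Qed.

Lemma ar_weight_normal_right j (k : 'I_n) :
  \sum_(t < n) A (n - t)%N j * c (t%:Z - k%:Z) = c ((n.+1 + j)%N%:Z - k.+1%:Z).
Proof.
rewrite (_ : (n.+1 + j)%N%:Z - k.+1%:Z = j%:Z + (n - k)%N%:Z); last first.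
  by have := ltn_ord k; lia.
rewrite -ar_weight_normal ?subn_gt0// (reindex_inj rev_ord_inj)/=.
apply: eq_bigr => l _; rewrite subKn// -cN.
by congr (_ * c _); have := ltn_ord k; have := ltn_ord l; lia.
Qed.

Let pred_coefP tau (a : 'I_n -> R) t :
  (forall k : 'I_n, \sum_(t < n) a t * c (t%:Z - k%:Z) = c (tau - k.+1%:Z)) ->
  pred_coef n f tau 0 t = a t.
Proof.
move=> aeq; rewrite /pred_coef (@best_pred_unique _ _ _ cN _ _ (\row_t a t)) => [||k].
- by rewrite (@xget_unique _ _ _ (\row_t a t)) ?mxE.
- by move=> x i; exact: (ar_autocov_posdef causal sigma2_gt0 cf).
- by rewrite -aeq; apply: eq_bigr => ? _; rewrite mxE.
Qed.

Lemma pred_coef_left j (t : 'I_n) : pred_coef n f (- j%:Z) 0 t = A t.+1 j.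
Proof. by rewrite (pred_coefP t (ar_weight_normal_left j)). Qed.

Lemma pred_coef_right j (t : 'I_n) :
  pred_coef n f (n.+1 + j)%N%:Z 0 t = A (n - t)%N j.
Proof. by rewrite (pred_coefP t (ar_weight_normal_right j)). Qed.

End ARPrediction.

(** * The predictive DFT and its boundary functions *)

Section ARTransforms.
Variables (R : realType) (p : nat) (phi : nat -> R) (sigma : R) (n : nat).
Hypothesis causal : forall z : R[i], root (ar_charpoly p phi) z -> 1 < `|z|.
Hypothesis sigma2_gt0 : 0 < sigma ^+ 2.
Hypothesis le_pn : (p <= n)%N.

Local Notation f := (ar_density sigma p phi).
Local Notation arpoly := (arpoly p phi).

(** The input [- arpoly`_(l + j)] of the weights is [phi_(l+j)] up to order [p]
    and [0] beyond. A general summand [F] covers complex and real sums. *)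
Lemma sum_arpoly_tail (V : nmodType) (F : R -> nat -> V) l :
  (0 < l)%N -> (forall j, F 0 j = 0) ->
  \sum_(j < p) F (- arpoly`_(l + j)) j
  = if (l <= p)%N then \sum_(0 <= j < (p - l).+1) F (phi (l + j)%N) j else 0.
Proof.
move=> l0 F0.
have coefN j : (l + j <= p)%N -> - arpoly`_(l + j) = phi (l + j)%N.
  by move=> lj; rewrite coef_arpoly /= addn_eq0 eqn0Ngt l0/= lj opprK.
have coef0 j : (p < l + j)%N -> F (- arpoly`_(l + j)) j = 0.
  move=> lj; rewrite coef_arpoly /= addn_eq0 eqn0Ngt l0/= leqNgt lj/=.
  by rewrite oppr0.
case: leqP => [lp|pl]; last first.
  by rewrite big1// => j _; rewrite coef0// ltn_addr.
have lep : ((p - l).+1 <= p)%N by rewrite ltn_subrL l0 (leq_trans l0).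
rewrite big_mkord (big_ord_widen _ (fun j => F (phi (l + j)%N) j) lep).
rewrite [RHS]big_mkcond; apply: eq_bigr => j _; case: ifPn => [jl|].
  by rewrite coefN// -leq_subRL// -ltnS.
by rewrite -leqNgt => jl; rewrite coef0// -ltn_subLR//.
Qed.

(** The boundary function [phi_{l,p}], extended by [0] to [l > p]. *)
Definition ar_phi0 (l : nat) (w : R) : R[i] :=
  if (l <= p)%N then ar_phi p phi l w else 0.

Lemma conj_ar_phi0 l w : (ar_phi0 l w)^* = ar_phi0 l (- w).
Proof.
rewrite /ar_phi0; case: ifP => _; last exact: rmorph0.
rewrite /ar_phi rmorphM fmorphV [X in X^-1 * _ = _]conj_ar_fun rmorph_sum.
congr (_ * _); apply: eq_bigr => s _.
by rewrite rmorphM [X in X * _]conjc_real [X in _ * X]conj_expi mulrN.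
Qed.

Lemma ar_phi0E l w : (0 < l)%N ->
  ar_phi0 l w = (ar_fun p phi w)^-1 * \sum_(j < p) (- arpoly`_(l + j))%:C * expi (- w) ^+ j.
Proof.
move=> l0; rewrite /ar_phi0.
rewrite (@sum_arpoly_tail _ (fun a j => a%:C * expi (- w) ^+ j))//; last by move=> j; rewrite mul0r.
case: ifP => _; last by rewrite mulr0.
by congr (_ * _); apply: eq_bigr => s _; rewrite -expiMn mulrN.
Qed.

Variable A : nat -> nat -> R.
Hypothesis convA : forall l j, conv arpoly (A l) j = - arpoly`_(l + j).

Let has_csum_weight l w : (0 < l)%N ->
  has_csum (fun j => (A l j)%:C * expi (- w) ^+ j) (ar_phi0 l w).
Proof.
move=> l0; rewrite ar_phi0E// -[X in ar_fun p phi X](opprK w).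
apply: (has_csum_ar causal (convA l)) => j pj.
by rewrite coef_arpoly /= addn_eq0 eqn0Ngt l0/= leqNgt (leq_trans _ (leq_add l0 pj)) ?oppr0// add1n.
Qed.

Lemma has_csum_Jhat_left X w :
  has_csum (Jhat_left n f X w) (\sum_(t < n) (X t.+1)%:C * ar_phi0 t.+1 w).
Proof.
have := has_csum_sum (r := index_enum 'I_n)
  (fun t : 'I_n => has_csumZ (X t.+1)%:C (@has_csum_weight t.+1 w isT)).
apply: eq_has_csum => j; rewrite /Jhat_left /Xhat rmorph_sum mulr_suml.
apply: eq_bigr => t _.
rewrite (pred_coef_left causal sigma2_gt0 le_pn convA) rmorphM/=.
by rewrite rmorphN mulNr -mulrN expiMn mulrAC mulrC.
Qed.

Lemma has_csum_Jhat_right X w :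
  has_csum (Jhat_right n f X w)
    (expi (n.+1%:R * w) * \sum_(t < n) (X t.+1)%:C * ar_phi0 (n - t) (- w)).
Proof.
have nt0 (t : 'I_n) : (0 < n - t)%N by rewrite subn_gt0.
have := has_csumZ (expi (n.+1%:R * w)) (has_csum_sum (r := index_enum 'I_n)
  (fun t : 'I_n => has_csumZ (X t.+1)%:C (@has_csum_weight _ (- w) (nt0 t)))).
apply: eq_has_csum => j; rewrite /Jhat_right /Xhat rmorph_sum mulr_suml mulr_sumr.
apply: eq_bigr => t _.
rewrite (pred_coef_right causal sigma2_gt0 le_pn convA) rmorphM/= opprK.
rewrite natrD mulrDl expiD [expi (j%:R * w)]expiMn.
rewrite [RHS]mulrACA [X in _ = X * _]mulrC -[RHS]mulrA; congr (_ * _).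
exact: mulrCA.
Qed.

Lemma has_csum_Dmx_term (k t : 'I_n) :
  has_csum (Dmx_term f k t)
    (ar_phi0 t.+1 (omega R n k.+1)
     + expi (omega R n k.+1) * ar_phi0 (n - t) (- omega R n k.+1)).
Proof.
have nt0 : (0 < n - t)%N by rewrite subn_gt0.
have := has_csumD (@has_csum_weight t.+1 (omega R n k.+1) isT)
  (has_csumZ (expi (omega R n k.+1)) (@has_csum_weight _ (- omega R n k.+1) nt0)).
apply: eq_has_csum => j; rewrite /Dmx_term.
rewrite !(pred_coef_left causal sigma2_gt0 le_pn convA) /= subnSK//; congr (_ + _).
  by rewrite rmorphN mulNr -mulrN expiMn.
rewrite mulrCA opprK -expiMn -expiD; congr (_ * expi _).
have -> : - (- j%:Z - 1)%:~R = 1 + j%:R :> R by rewrite rmorphB rmorphN /=; ring.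
by rewrite mulrDl mul1r.
Qed.

End ARTransforms.

(** * DFT matrices *)

Section Circulant.
Variables (R : realType) (n : nat).
Hypothesis n_gt0 : (0 < n)%N.
Local Notation isq := ((Num.sqrt n%:R)^-1%:C : R[i]).

Lemma isq_sqr : isq * isq = (n%:R)^-1.
Proof.
rewrite -rmorphM -invfM -expr2 sqr_sqrtr ?ler0n//.
by rewrite fmorphV rmorph_nat.
Qed.

Lemma Fmx_adjE (g : R -> R) m (M : 'M[R[i]]_(n, m)) s t :
  ((Fmx R n)^t* *m Delta n g *m M) s t
  = isq * \sum_(k < n) expi (- (s.+1%:R * omega R n k.+1)) * (g (omega R n k.+1))%:C * M k t.
Proof.
rewrite mxE mulr_sumr; apply: eq_bigr => k _.
rewrite mul_mx_diag !mxE rmorphM !mulrA; congr (_ * _ * _ * _).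
  exact: conjc_real.
exact: conj_expi.
Qed.

Lemma Fmx_unitary : (Fmx R n)^t* *m Fmx R n = 1%:M.
Proof.
apply/matrixP => s t; rewrite !mxE.
under eq_bigr => k _.
  rewrite !mxE rmorphM [X in X * _ * _]conjc_real [X in _ * X * _]conj_expi.
  rewrite mulrACA isq_sqr -expiD -mulNr -mulrDl.
  rewrite (_ : - s.+1%:R + t.+1%:R = (t%:Z - s%:Z)%:~R); last first.
    by rewrite rmorphB/= -!nat1r; ring.
  over.
rewrite -mulr_sumr sum_expi_omegaS//.
have nC : (n%:R : R[i]) != 0 by rewrite pnatr_eq0 -lt0n.
case: ifPn => [dv|ndv].
  rewrite mulVf//; suff -> : s = t by rewrite eqxx.
  apply/val_inj; move: dv; rewrite -eqz_mod_dvd !modz_nat !modn_small//.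
  by case/eqP=> ts; rewrite /= ts.
rewrite mulr0; case: eqVneq => // st.
by move: ndv; rewrite st subrr dvdz0.
Qed.

End Circulant.

Section ARMatrices.
Variables (R : realType) (p : nat) (phi : nat -> R) (sigma : R) (n : nat).
Hypothesis n_gt0 : (0 < n)%N.
Hypothesis causal : forall z : R[i], root (ar_charpoly p phi) z -> 1 < `|z|.
Hypothesis sigma2_gt0 : 0 < sigma ^+ 2.
Hypothesis le_pn : (p <= n)%N.

Local Notation isq := ((Num.sqrt n%:R)^-1%:C : R[i]).
Local Notation f := (ar_density sigma p phi).
Local Notation finv := (fun w : R => (f w)^-1).
Local Notation c := (autocov f).
Local Notation arpoly := (arpoly p phi).
Local Notation phi0 := (ar_phi0 p phi).
Local Notation om k := (omega R n k.+1).

Lemma DmxE (k t : 'I_n) :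
  Dmx n f k t = isq * (phi0 t.+1 (om k) + expi (om k) * phi0 (n - t) (- om k)).
Proof.
have [A convA] := ar_weight_exists p phi.
rewrite mxE (has_csumE (has_csum_Dmx_term causal sigma2_gt0 le_pn convA (k:=k) (t:=t))).
by [].
Qed.

(** The full DFT of the series completed by its best predictors has
    covariance [f(w) e^{isw}] with [X_s], as if the whole series were observed. *)
Lemma Dmx_Gamma :
  (Fmx R n + Dmx n f) *m map_mx (real_complex R) (Gamma n f)
  = Delta n f *m Fmx R n.
Proof.
have [A convA] := ar_weight_exists p phi.
have cf := (is_autocovP _ _).1 (autocovP sigma causal).
apply/matrixP => k s; set w := om k.
pose c' (r : int) := c (r - s.+1%:Z).
have [_ _ /(_ w)[l hl hm]] := fourier_shift s.+1%:Z cf.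
have hleft := (has_csum_cons (fun j : nat => fterm c' w (- j%:Z)) _).1 hm.
have hright := (has_csum_add n.+1 (fun j : nat => fterm c' w j%:Z) (l - \sum_(j < n.+1) fterm c' w j%:Z)).2.
rewrite subrKC in hright; have {}hright := hright hl.
have hsum := has_csumD hleft hright.
have hD := has_csum_sum (r := index_enum 'I_n) (fun t : 'I_n =>
  has_csumZ (c (t%:Z - s%:Z))%:C (has_csum_Dmx_term causal sigma2_gt0 le_pn convA (k:=k) (t:=t))).
have hE : (fun j => \sum_(t < n) (c (t%:Z - s%:Z))%:C * Dmx_term f k t j)
    =1 (fun j : nat => fterm c' w (- j%:Z) + fterm c' w (n.+1 + j)%N%:Z).
  move=> j.
  under eq_bigr => t _.
    rewrite /Dmx_term !(pred_coef_left causal sigma2_gt0 le_pn convA) /= subnSK//.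
    rewrite mulrDr mulrA [X in _ + X]mulrA -!rmorphM ![c _ * _]mulrC.
    over.
  rewrite big_split -!mulr_suml -!rmorph_sum /=.
  rewrite (ar_weight_normal_left causal sigma2_gt0 le_pn convA).
  rewrite (ar_weight_normal_right causal sigma2_gt0 le_pn convA); congr (_ + _ * _) => //.
  have -> : ((n.+1 + j)%N%:Z)%:~R = (n%:Z * 1)%:~R + (1 + j%:R) :> R.
    by rewrite -[LHS]/((n.+1 + j)%:R) mulr1 natrD -nat1r -[n%:Z%:~R]/(n%:R : R); ring.
  rewrite mulrDl expiD expi_omega_period// mul1r; congr expi; congr (_ * _).
  by rewrite rmorphB rmorphN /=; ring.
have := has_csum_uniq hsum (eq_has_csum hE hD).
have -> : \sum_(j < n.+1) fterm c' w j%:Z = fterm c' w 0 + \sum_(t < n) fterm c' w t.+1%:Z.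
  by rewrite big_ord_recl.
move=> sumE.
have entryE (t : 'I_n) : (Fmx R n + Dmx n f) k t * (map_mx (real_complex R) (Gamma n f)) t s
    = isq * (fterm c' w t.+1%:Z + (c (t%:Z - s%:Z))%:C
        * (phi0 t.+1 w + expi w * phi0 (n - t) (- w))).
  rewrite mxE DmxE [map_mx _ _ _ _]mxE [Gamma _ _ _ _]mxE [Fmx _ _ _ _]mxE -mulrDr -mulrA.
  congr (_ * _); rewrite mulrDl /fterm /c' [_ * expi _]mulrC [X in _ + X]mulrC.
  by congr (expi _ * (c _)%:C + _); lia.
rewrite [LHS]mxE (eq_bigr _ (fun t _ => entryE t)) -mulr_sumr big_split /= -sumE.
rewrite mul_diag_mx !mxE [RHS]mulrCA; congr (_ * _); rewrite -/w oppr0.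
move: (\sum_(t < n) _) (fterm c' w 0) => S x; ring.
Qed.

End ARMatrices.

Lemma mulf_cancel_mid (F : fieldType) (x y a b z : F) : a != 0 ->
  x * (y * (a * b)) * (a^-1 * z) = y * (x * (b * z)).
Proof. by move=> a0; field. Qed.

Section ARCirculant.
Variables (R : realType) (p : nat) (phi : nat -> R) (sigma : R) (n : nat).
Hypothesis causal : forall z : R[i], root (ar_charpoly p phi) z -> 1 < `|z|.
Hypothesis lt_pn : (p < n)%N.

Local Notation f := (ar_density sigma p phi).
Local Notation arpoly := (arpoly p phi).
Local Notation phi0 := (ar_phi0 p phi).
Local Notation om k := (omega R n k.+1).

Let n_gt0 : (0 < n)%N. Proof. exact: leq_ltn_trans lt_pn. Qed.

Lemma sum_arpoly_mod (r : int) :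
  \sum_(u < p.+1) (if (n%:Z %| u%:Z - r)%Z then arpoly`_u else 0)
  = ar_tilde p phi (r %% n%:Z)%Z.
Proof.
have n0 : n%:Z != 0 by rewrite -[0]/(0%:Z) eqz_nat -lt0n.
have := ltz_pmod r (n_gt0 : 0 < n%:Z); have := modz_ge0 r n0.
case rE : (r %% n%:Z)%Z => [m|]// _; rewrite ltz_nat => mn.
rewrite -coef_arpoly.
under eq_bigr => u _.
  rewrite -eqz_mod_dvd rE modz_nat modn_small ?(leq_trans (ltn_ord u))//.
  over.
rewrite -big_mkcond /=.
have [mp|pm] := ltnP m p.+1.
  by rewrite (big_pred1 (Ordinal mp))// => u; rewrite -val_eqE.
rewrite big1 ?nth_default// ?(leq_trans (size_poly _ _))// => u /eqP[um].
by have := ltn_ord u; rewrite um ltnNge pm.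
Qed.

(** [phi_{l,p} / f] is the trigonometric polynomial
    [sigma^-2 phi(e^{iw}) sum_j phi_(l+j) e^{-ijw}]; sampling it at the [n]-th
    roots of unity identifies frequencies that agree modulo [n]. *)
Lemma circulant_phi0 l (m : int) : (0 < l)%N ->
  (n%:R)^-1 * (\sum_(k < n) expi (- (m%:~R * om k)) * (f (om k))^-1%:C * phi0 l (om k))
  = (sigma ^- 2 * \sum_(j < p) (- arpoly`_(l + j)) * ar_tilde p phi ((j%:Z + m) %% n%:Z)%Z)%:C.
Proof.
move=> l0.
have nC : (n%:R : R[i]) != 0 by rewrite pnatr_eq0 -lt0n.
have termE (k : 'I_n) : expi (- (m%:~R * om k)) * (f (om k))^-1%:C * phi0 l (om k)
    = (sigma ^- 2)%:C * \sum_(j < p) \sum_(u < p.+1)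
        (- arpoly`_(l + j) * arpoly`_u)%:C * expi ((u%:Z - (j%:Z + m))%:~R * om k).
  have fV : (f (om k))^-1%:C
      = (sigma ^- 2)%:C * (ar_fun p phi (om k) * ar_fun p phi (- om k)).
    by rewrite [LHS]fmorphV [X in X^-1]ar_densityE invf_div [LHS]mulrC [in RHS]fmorphV.
  rewrite ar_phi0E// fV.
  rewrite mulf_cancel_mid ?ar_fun_neq0//; congr (_ * _).
  rewrite ar_funNE -map_arpoly (@horner_coef_wide _ p.+1) ?size_map_poly ?size_poly//.
  rewrite mulrA mulrC mulr_suml; apply: eq_bigr => j _; rewrite mulrA mulr_sumr.
  apply: eq_bigr => u _; rewrite coef_map rmorphM.
  have -> : (u%:Z - (j%:Z + m))%:~R * om k = j%:R * - om k - m%:~R * om k + u%:R * om k.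
    by rewrite rmorphB rmorphD /=; ring.
  by rewrite !expiD -!expiMn -[_ * expi (j%:R * _) * _]mulrA mulrACA.
rewrite (eq_bigr _ (fun k _ => termE k)) -mulr_sumr mulrCA rmorphM; congr (_ * _).
rewrite exchange_big mulr_sumr rmorph_sum; apply: eq_bigr => j _.
rewrite exchange_big mulr_sumr rmorphM -sum_arpoly_mod rmorph_sum mulr_sumr.
apply: eq_bigr => u _; rewrite -mulr_sumr sum_expi_omegaS//.
case: ifP => _; last by rewrite !(mulr0, rmorph0).
by rewrite mulrCA mulVf// mulr1 rmorphM.
Qed.

End ARCirculant.

Section ARFormulas.
Variables (R : realType) (p : nat) (phi : nat -> R) (sigma : R) (n : nat).
Hypothesis causal : forall z : R[i], root (ar_charpoly p phi) z -> 1 < `|z|.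
Hypothesis sigma2_gt0 : 0 < sigma ^+ 2.
Hypothesis le_pn : (p <= n)%N.
Hypothesis n_gt0 : (0 < n)%N.

Local Notation f := (ar_density sigma p phi).
Local Notation phi0 := (ar_phi0 p phi).
Local Notation D := (Dmx n f).
Local Notation isq := ((Num.sqrt n%:R)^-1%:C : R[i]).
Local Notation om k := (omega R n k.+1).

Lemma ar_phi0_gt l w : (p < l)%N -> phi0 l w = 0.
Proof. by move=> pl; rewrite /ar_phi0 leqNgt pl. Qed.

Lemma sum_ar_phi0 (Y : nat -> R[i]) w :
  \sum_(t < n) Y t.+1 * phi0 t.+1 w
  = (ar_fun p phi w)^-1 * \sum_(1 <= l < p.+1) Y l
      * \sum_(0 <= s < (p - l).+1) (phi (l + s)%N)%:C * expi (- (s%:R * w)).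
Proof.
pose G l := (ar_fun p phi w)^-1 * (Y l.+1
  * \sum_(0 <= s < (p - l.+1).+1) (phi (l.+1 + s)%N)%:C * expi (- (s%:R * w))).
rewrite big_add1 big_mkord mulr_sumr (big_ord_widen n G le_pn) [RHS]big_mkcond.
apply: eq_bigr => t _; rewrite /ar_phi0; case: ifP => _; last by rewrite mulr0.
by rewrite mulrCA.
Qed.

Lemma sum_ar_phi0_rev (X : nat -> R[i]) w :
  \sum_(t < n) X t.+1 * phi0 (n - t) w = \sum_(t < n) X (n.+1 - t.+1)%N * phi0 t.+1 w.
Proof.
rewrite (reindex_inj rev_ord_inj) /=; apply: eq_bigr => t _.
by rewrite subKn// subSS -subSn.
Qed.

Lemma JhatE X w :
  Jhat n f X w = isq * (\sum_(t < n) (X t.+1)%:C * phi0 t.+1 w)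
    + isq * (expi (n.+1%:R * w) * \sum_(t < n) (X t.+1)%:C * phi0 (n - t) (- w)).
Proof.
have [A convA] := ar_weight_exists p phi; rewrite /Jhat.
rewrite (has_csumE (has_csum_Jhat_left causal sigma2_gt0 le_pn convA (X:=X) (w:=w))).
by rewrite (has_csumE (has_csum_Jhat_right causal sigma2_gt0 le_pn convA (X:=X) (w:=w))).
Qed.

End ARFormulas.

Section ARInverse.
Variables (R : realType) (p : nat) (phi : nat -> R) (sigma : R) (n : nat).
Hypothesis causal : forall z : R[i], root (ar_charpoly p phi) z -> 1 < `|z|.
Hypothesis sigma2_gt0 : 0 < sigma ^+ 2.
Hypothesis lt_pn : (p < n)%N.

Local Notation f := (ar_density sigma p phi).
Local Notation phi0 := (ar_phi0 p phi).
Local Notation D := (Dmx n f).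
Local Notation finv := (fun w : R => (f w)^-1).
Local Notation isq := ((Num.sqrt n%:R)^-1%:C : R[i]).
Local Notation om k := (omega R n k.+1).

Let le_pn : (p <= n)%N := ltnW lt_pn.
Let n_gt0 : (0 < n)%N. Proof. exact: leq_ltn_trans lt_pn. Qed.

Lemma ar_density_neq0 w : f w != 0.
Proof.
have [m m0 /(_ w) mf] := ar_density_ge causal sigma2_gt0.
by rewrite gt_eqF// (lt_le_trans m0).
Qed.

Lemma Gamma_left_inverse :
  ((Fmx R n)^t* *m Delta n finv *m (Fmx R n + D)) *m map_mx (real_complex R) (Gamma n f) = 1%:M.
Proof.
rewrite -mulmxA (Dmx_Gamma n_gt0 causal sigma2_gt0 le_pn) mulmxA -[_ *m _ *m Delta n f]mulmxA.
have -> : Delta n finv *m Delta n f = 1%:M.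
  apply/matrixP => i j; rewrite mul_diag_mx !mxE.
  case: eqVneq => [_|_]; last by rewrite mulr0n mulr0.
  by rewrite !mulr1n -rmorphM mulVf ?ar_density_neq0.
by rewrite mulmx1 Fmx_unitary.
Qed.

Lemma Gamma_unit : Gamma n f \in unitmx.
Proof.
by have [_] := mulmx1_unit Gamma_left_inverse; rewrite map_unitmx.
Qed.

Lemma Gamma_inv : map_mx (real_complex R) (invmx (Gamma n f)) - circ n finv
  = (Fmx R n)^t* *m Delta n finv *m D.
Proof.
have Gu : map_mx (real_complex R) (Gamma n f) \in unitmx by rewrite map_unitmx Gamma_unit.
rewrite map_invmx -[invmx _]mul1mx -Gamma_left_inverse mulmxK//.
by rewrite mulmxDr addrAC subrr add0r.
Qed.

(** The contribution of the right end is the conjugate of a contribution of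
    the left end, and is real. *)
Lemma circulant_Dmx (s t : 'I_n) :
  ((Fmx R n)^t* *m Delta n finv *m D) s t
  = (sigma ^- 2 * (\sum_(j < p) (- (arpoly p phi)`_(t.+1 + j))
                    * ar_tilde p phi ((j%:Z + s.+1%:Z) %% n%:Z)%Z
      + \sum_(j < p) (- (arpoly p phi)`_((n - t) + j))
                    * ar_tilde p phi ((j%:Z - s%:Z) %% n%:Z)%Z))%:C.
Proof.
have nt : (0 < n - t)%N by rewrite subn_gt0.
have c1 := circulant_phi0 sigma causal lt_pn s.+1%:Z (ltn0Sn t).
have c2 := circulant_phi0 sigma causal lt_pn (- s%:Z) nt.
have {}c2 : (n%:R)^-1 * (\sum_(k < n) expi (- (s%:R * om k)) * (f (om k))^-1%:C
      * phi0 (n - t) (- om k))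
    = (sigma ^- 2 * \sum_(j < p) (- (arpoly p phi)`_((n - t) + j))
                    * ar_tilde p phi ((j%:Z - s%:Z) %% n%:Z)%Z)%:C.
  rewrite -[RHS]conjc_real -c2 [RHS]rmorphM rmorph_sum.
  rewrite [X in _ = X * _](_ : _ = (n%:R)^-1); last by rewrite fmorphV; congr (_^-1); exact: conjc_nat.
  congr (_ * _); apply: eq_bigr => k _; rewrite 2!rmorphM.
  rewrite [X in _ = X * _ * _]conj_expi [X in _ = _ * X * _]conjc_real.
  rewrite [X in _ = _ * _ * X]conj_ar_phi0 opprK.
  by rewrite rmorphN mulNr.
rewrite mulrDr [RHS](rmorphD (real_complex R)) [X in _ = X + _]/= -[X in _ = X + _]c1 -[X in _ = _ + X]c2.
rewrite Fmx_adjE -mulrDr -isq_sqr// -[RHS]mulrA -big_split.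
congr (_ * _); rewrite mulr_sumr; apply: eq_bigr => k _ /=.
rewrite DmxE// mulrCA -[s.+1%:Z%:~R]/(s.+1%:R); congr (_ * _).
rewrite mulrDr; congr (_ + _); rewrite mulrA; congr (_ * _).
rewrite mulrAC -expiD; congr (expi _ * _).
by rewrite -nat1r; ring.
Qed.

End ARInverse.

(** * The rank of the boundary matrix *)

Lemma addf_clear_denom (F : comPzRingType) (v z x y A B : F) :
  A + z * B = 0 -> v * (x * A) * y + y * B * (z * v * x) = 0.
Proof.
move=> AB; have -> : v * (x * A) * y + y * B * (z * v * x) = v * x * y * (A + z * B) by ring.
by rewrite AB mulr0.
Qed.

Section ARRank.
Variables (R : realType) (p : nat) (phi : nat -> R) (n : nat).
Hypothesis causal : forall z : R[i], root (ar_charpoly p phi) z -> 1 < `|z|.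
Hypothesis le_2pn : (2 * p <= n)%N.
Hypothesis p_gt0 : (0 < p)%N.
Hypothesis phip_neq0 : phi p != 0.

Local Notation arpoly := (arpoly p phi).
Local Notation phi0 := (ar_phi0 p phi).
Local Notation char := (ar_charpoly p phi).
Local Notation om k := (omega R n k.+1).

(** Combinations of boundary functions have the common denominator [phi]; this
    is the numerator, as a polynomial in [e^{-iw}]. *)
Definition boundary_poly (a : 'I_p -> R[i]) : {poly R[i]} :=
  \poly_(i < p) \sum_(j < p) a j * (- arpoly`_(j.+1 + i))%:C.

Lemma horner_boundary_poly a w :
  (boundary_poly a).[expi (- w)] = ar_fun p phi w * \sum_(j < p) a j * phi0 j.+1 w.
Proof.
rewrite horner_poly mulr_sumr.
under eq_bigr do rewrite mulr_suml.
rewrite exchange_big; apply: eq_bigr => j _.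
rewrite ar_phi0E// mulrCA mulVKf ?ar_fun_neq0// mulr_sumr.
by apply: eq_bigr => i _; rewrite mulrA.
Qed.

(** The coefficients of [boundary_poly a] are a triangular combination of the
    [a j], with [phi p] on the diagonal. *)
Lemma boundary_poly_inj a : boundary_poly a = 0 -> forall j, a j = 0.
Proof.
move=> a0 j; have [m] := ubnP (val j); elim: m j => // m IHm j jm.
have := congr1 (fun P : {poly R[i]} => P`_(p.-1 - j)) a0.
have lt_p : (p.-1 - j < p)%N by rewrite (leq_ltn_trans (leq_subr _ _))// ltn_predL.
rewrite coef0 coef_poly lt_p (bigD1 j)//= big1 ?addr0 => [|i ij].
  have -> : (j.+1 + (p.-1 - j) = p)%N by have := ltn_ord j; lia.
  rewrite coef_arpoly /= -[p == 0]negbK -lt0n p_gt0 leqnn opprK => /eqP.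
  by rewrite mulf_eq0 fmorph_eq0 (negPf phip_neq0) orbF => /eqP.
have [lt_ij|] := ltnP i j; first by rewrite IHm ?mul0r// (leq_trans lt_ij).
rewrite leq_eqVlt eq_sym (negPf (ij : val i != val j)) => lt_ji.
rewrite nth_default ?oppr0 ?mulr0// (leq_trans (size_poly _ _))//.
by have := ltn_ord i; lia.
Qed.

Lemma size_charpoly : size char = p.+1.
Proof.
apply/eqP; rewrite -map_arpoly size_map_poly eqn_leq size_poly ltnNge.
apply/negP => sp; have := nth_default 0 sp.
by rewrite coef_arpoly /= -[p == 0]negbK -lt0n p_gt0 leqnn => /eqP; rewrite oppr_eq0 (negPf phip_neq0).
Qed.

(** Clearing denominators, a dependency between the boundary columns is a
    polynomial of degree below [2 p <= n] vanishing at all [n]-th roots of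
    unity; coprimality of [phi(z)] and [z^p phi(1/z)] then separates the two
    ends. *)
Lemma boundary_free (a b : 'I_p -> R[i]) :
  (forall k : 'I_n, \sum_(j < p) a j * phi0 j.+1 (om k)
     + expi (om k) * \sum_(j < p) b j * phi0 j.+1 (- om k) = 0) ->
  (forall j, a j = 0) /\ (forall j, b j = 0).
Proof.
move=> ab0; pose charR := map_poly (real_complex R) (ar_reversed p phi).
pose Va := rev_poly p.-1 (boundary_poly a); pose Ub := boundary_poly b.
have sV : (size Va <= p)%N by rewrite (leq_trans (size_poly _ _))// prednK.
have sU : (size Ub <= p)%N by exact: size_poly.
have Q0 : Va * char + Ub * charR = 0.
  apply/eqP/negPn/negP => Qneq0.
  have rQ : all (root (Va * char + Ub * charR)) [seq expi (om k) | k : 'I_n].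
    apply/allP => _ /mapP[k _ ->]; apply/rootP.
    have z0 := expi_neq0 (om k).
    rewrite hornerD !hornerM -ar_funNE horner_ar_reversed//.
    rewrite horner_rev_poly// ?prednK ?size_poly//.
    rewrite -expiN -ar_funE horner_boundary_poly -[X in Ub.[expi X]]opprK horner_boundary_poly.
    rewrite -[X in _ ^+ X * ar_fun _ _ _](prednK p_gt0) exprS.
    exact: addf_clear_denom (ab0 k).
  have uQ : uniq [seq expi (om k) | k : 'I_n].
    by rewrite map_inj_uniq ?enum_uniq//; exact: expi_omegaS_inj.
  have := max_poly_roots Qneq0 rQ uQ; rewrite size_map size_enum_ord ltnNge.
  rewrite (leq_trans _ le_2pn)// (leq_trans (size_polyD _ _))// geq_max.
  have szM (P Q : {poly R[i]}) : (size P <= p)%N -> (size Q <= p.+1)%N ->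
      (size (P * Q)%R <= 2 * p)%N.
    by move=> sP sQ; have := size_polyMleq P Q; lia.
  by rewrite !szM// ?size_charpoly// size_map_poly size_poly.
have Ub0 : Ub = 0.
  apply/eqP/negPn/negP => Un0.
  have : char %| Ub * charR.
    have -> : Ub * charR = - (Va * char) by apply/eqP; rewrite -addr_eq0 addrC Q0.
    by rewrite dvdpNr dvdp_mull.
  rewrite Gauss_dvdpl -?map_arpoly ?coprimep_map ?coprime_ar_reversed//.
  move=> /dvdp_leq; rewrite map_arpoly size_charpoly => /(_ Un0).
  by rewrite leqNgt ltnS sU.
have Va0 : Va = 0.
  have c0 : char != 0 by rewrite -size_poly_eq0 size_charpoly.
  by move/eqP: Q0; rewrite Ub0 mul0r addr0 mulf_eq0 (negPf c0) orbF => /eqP.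
split; apply: boundary_poly_inj => //; apply/polyP => i; rewrite coef0.
have [ip|pi] := ltnP i p; last by rewrite nth_default// (leq_trans (size_poly _ _)).
have := congr1 (fun P : {poly R[i]} => P`_(p.-1 - i)) Va0.
by rewrite coef0 coef_poly ltnS leq_subr subKn// -ltnS prednK.
Qed.

End ARRank.

Section BoundaryRank.
Variables (R : realType) (p : nat) (phi : nat -> R) (sigma : R) (n : nat).
Hypothesis causal : forall z : R[i], root (ar_charpoly p phi) z -> 1 < `|z|.
Hypothesis sigma2_gt0 : 0 < sigma ^+ 2.
Hypothesis le_pn : (p <= n)%N.
Hypothesis n_gt0 : (0 < n)%N.

Local Notation f := (ar_density sigma p phi).
Local Notation phi0 := (ar_phi0 p phi).
Local Notation D := (Dmx n f).
Local Notation isq := ((Num.sqrt n%:R)^-1%:C : R[i]).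
Local Notation om k := (omega R n k.+1).

Hypothesis le_2pn : (2 * p <= n)%N.

Lemma Dmx_left (k t : 'I_n) : (t < p)%N -> D k t = isq * phi0 t.+1 (om k).
Proof.
move=> tp; rewrite DmxE// [X in _ + expi _ * X]ar_phi0_gt ?mulr0 ?addr0//.
by have := ltn_ord t; lia.
Qed.

Lemma Dmx_right (k t : 'I_n) : (n - t <= p)%N ->
  D k t = isq * (expi (om k) * phi0 (n - t) (- om k)).
Proof.
move=> tp; rewrite DmxE// [phi0 t.+1 _]ar_phi0_gt ?add0r//.
by have := ltn_ord t; lia.
Qed.

Lemma Dmx_middle (k t : 'I_n) : (p <= t)%N -> (p < n - t)%N -> D k t = 0.
Proof.
by move=> pt tp; rewrite DmxE// !ar_phi0_gt// mulr0 addr0 mulr0.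
Qed.

(** The rows of [B] in the proof are the [2p] boundary columns of [D]; they
    contain all nonzero columns and are free by [boundary_free]. *)
Lemma rank_Dmx : ((0 < p)%N -> phi p != 0) -> \rank D = (2 * p)%N.
Proof.
move=> phip; rewrite mul2n -addnn -mxrank_tr.
pose idx (i : 'I_(p + p)) : 'I_n :=
  match fintype.split i with inl j => widen_ord le_pn j | inr j => rev_ord (widen_ord le_pn j) end.
have idxl j : idx (lshift p j) = widen_ord le_pn j.
  by rewrite /idx; case: fintype.splitP => j' //=; [move=> /val_inj -> | have := ltn_ord j; lia].
have idxr j : idx (rshift p j) = rev_ord (widen_ord le_pn j).
  by rewrite /idx; case: fintype.splitP => j' /=; [have := ltn_ord j'; lia | move=> /addnI/val_inj ->].
pose B : 'M[R[i]]_(p + p, n) := \matrix_(i, k) D k (idx i).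
have rowB i : row i B = row (idx i) D^T by apply/rowP => k; rewrite !mxE.
apply/eqP; rewrite eqn_leq; apply/andP; split.
  rewrite (leq_trans _ (rank_leq_row B))// mxrankS//; apply/row_subP => t.
  have [tp|pt] := ltnP t p.
    rewrite (_ : t = idx (lshift p (Ordinal tp))) -?rowB ?row_sub// idxl.
    exact: val_inj.
  have [tp|pnt] := leqP (n - t) p.
    have jp : (n - t.+1 < p)%N by have := ltn_ord t; lia.
    rewrite (_ : t = idx (rshift p (Ordinal jp))) -?rowB ?row_sub// idxr.
    by apply/val_inj => /=; have := ltn_ord t; lia.
  rewrite (_ : row t _ = 0) ?sub0mx//; apply/rowP => k.
  by rewrite [LHS]mxE [LHS]mxE Dmx_middle// [RHS]mxE.
suff /eqP <- : row_free B.
  by rewrite mxrankS//; apply/row_subP => i; rewrite rowB row_sub.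
rewrite -kermx_eq0; apply/eqP/row_matrixP => i; rewrite row0.
have : (row i (kermx B) <= kermx B)%MS by exact: row_sub.
move: (row i (kermx B)) => v /sub_kermxP vB.
have [p0|p0] := posnP p.
  by apply/rowP => j; have := ltn_ord j; lia.
have [a0 b0] : (forall j, v 0 (lshift p j) = 0) /\ (forall j, v 0 (rshift p j) = 0).
  apply: (boundary_free causal le_2pn p0 (phip p0)) => k.
  have := congr1 (fun M : 'rV_n => M 0 k) vB.
  rewrite [LHS]mxE [RHS]mxE big_split_ord /=.
  under eq_bigr => j _ do rewrite [B _ _]mxE idxl Dmx_left//= mulrCA.
  under [X in _ + X]eq_bigr => j _.
    rewrite [B _ _]mxE idxr Dmx_right/= ?subKn ?(leq_trans (ltn_ord j))//.
    rewrite mulrCA [v 0 _ * (_ * _)]mulrCA.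
    over.
  rewrite -!mulr_sumr -mulrDr => /eqP; rewrite mulf_eq0 => /orP[|/eqP//].
  by rewrite fmorph_eq0 invr_eq0 sqrtr_eq0 lern0 -leqn0 leqNgt n_gt0.
apply/rowP => j; rewrite mxE -(fintype.splitK j).
by case: (fintype.split j) => j' /=.
Qed.

End BoundaryRank.

(** * Conclusion *)

Lemma mulf_shuffle (F : comPzRingType) (i e v x y : F) :
  i * (e * v * (x * y)) = v * (i * x) * (e * y).
Proof. by ring. Qed.

Theorem theorem2p3 (R : realType) (n p : nat) (sigma : R) (phi X : nat -> R)
    (n_gt0 : (0 < n)%N) (le_pn : (p <= n)%N) (sigma2_gt0 : 0 < sigma ^+ 2)
    (phi_causal : forall z : R[i], root (ar_charpoly p phi) z -> 1 < `|z|) :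
  let f := ar_density sigma p phi in
  let finv := fun w : R => (f w)^-1 in
  let phi_p := ar_fun p phi in
  let D := Dmx n f in
  let isqrtn : R[i] := (Num.sqrt n%:R)^-1%:C in
  let left_col (k t : nat) : R[i] := ar_phi p phi t (omega R n k) in
  let right_col (k t : nat) : R[i] :=
    expi (omega R n k) * (ar_phi p phi (n.+1 - t) (omega R n k))^* in
  [/\ (* predictive DFT *)
      forall w : R,
        [/\ csummable (Jhat_left n f X w), csummable (Jhat_right n f X w)
          & Jhat n f X w =
              isqrtn / phi_p w
              * (\sum_(1 <= l < p.+1) (X l)%:C
                   * \sum_(0 <= s < (p - l).+1)
                       (phi (l + s)%N)%:C * expi (- (s%:R * w)))
            + expi (n%:R * w) * (isqrtn / (phi_p w)^*)
              * (\sum_(1 <= l < p.+1) (X (n.+1 - l)%N)%:C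
                   * \sum_(0 <= s < (p - l).+1)
                       (phi (l + s)%N)%:C * expi (s.+1%:R * w))],
      (* the series defining the entries of D converge *)
      forall k t : 'I_n, csummable (Dmx_term f k t),
      (* p <= n / 2 *)
      (2 * p <= n)%N ->
        (((0 < p)%N -> phi p != 0) -> \rank D = (2 * p)%N) /\
        (forall k t : 'I_n,
           D k t = isqrtn *
             (if (t.+1 <= p)%N then left_col k.+1 t.+1
              else if (t.+1 <= n - p)%N then 0
              else right_col k.+1 t.+1)),
      (* n / 2 < p <= n *)
      (n < 2 * p)%N ->
        forall k t : 'I_n,
          D k t = isqrtn *
            ((if (t.+1 <= p)%N then left_col k.+1 t.+1 else 0) +
             (if (n - p + 1 <= t.+1)%N then right_col k.+1 t.+1 else 0))
    & (* 1 <= p <= n / 2 *)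
      (1 <= p)%N -> (2 * p <= n)%N ->
        [/\ Gamma n f \in unitmx,
            map_mx (real_complex R) (invmx (Gamma n f)) - circ n finv
              = (Fmx R n) ^t* *m Delta n finv *m D
          & forall s t : 'I_n,
              ((Fmx R n) ^t* *m Delta n finv *m D) s t =
              (if (t.+1 <= p)%N then
                 sigma ^- 2 *
                 \sum_(0 <= l < (p - t.+1).+1)
                   phi (l + t.+1)%N
                   * ar_tilde p phi ((l%:Z + s.+1%:Z) %% n%:Z)%Z
               else if (n - p + 1 <= t.+1)%N then
                 sigma ^- 2 *
                 \sum_(1 <= l < (p - (n - t.+1)).+1)
                   phi (l + (n - t.+1))%N
                   * ar_tilde p phi ((l%:Z - s.+1%:Z) %% n%:Z)%Z
               else 0)%:C]].
Proof.
move=> f finv phi_p D isqrtn left_col right_col.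
have [A convA] := ar_weight_exists p phi.
have right_colE k l (kn : (k < n)%N) : (n.+1 - l.+1 <= p)%N ->
    right_col k.+1 l.+1 = expi (omega R n k.+1) * ar_phi0 p phi (n - l) (- omega R n k.+1).
  move=> lp; rewrite /right_col -conj_ar_phi0 subSS in lp *.
  by rewrite /ar_phi0 lp.
split.
- move=> w; split.
  + exact: has_csum_summable (has_csum_Jhat_left phi_causal sigma2_gt0 le_pn convA (X:=X) (w:=w)).
  + exact: has_csum_summable (has_csum_Jhat_right phi_causal sigma2_gt0 le_pn convA (X:=X) (w:=w)).
  rewrite JhatE// (@sum_ar_phi0_rev R p phi n (fun l => (X l)%:C)).
  rewrite (@sum_ar_phi0 R p phi n le_pn (fun l => (X l)%:C)).
  rewrite (@sum_ar_phi0 R p phi n le_pn (fun l => (X (n.+1 - l)%N)%:C)).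
  congr (_ + _); first exact: mulrA.
  (* the right end carries one more factor [e^{iw}]: [tau] starts at [n + 1] *)
  have -> : \sum_(1 <= l < p.+1) (X (n.+1 - l)%N)%:C
        * (\sum_(0 <= s < (p - l).+1) (phi (l + s)%N)%:C * expi (s.+1%:R * w))
      = expi w * \sum_(1 <= l < p.+1) (X (n.+1 - l)%N)%:C
        * (\sum_(0 <= s < (p - l).+1) (phi (l + s)%N)%:C * expi (- (s%:R * - w))).
    rewrite mulr_sumr; apply: eq_bigr => l _; rewrite [RHS]mulrCA.
    congr (_ * _); rewrite mulr_sumr; apply: eq_bigr => s _; rewrite mulrCA -expiD.
    by rewrite mulrN opprK -nat1r mulrDl mul1r.
  have -> : expi (n.+1%:R * w) = expi w * expi (n%:R * w).
    by rewrite -expiD -nat1r mulrDl mul1r.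
  rewrite [X in isqrtn / X](conj_ar_fun p phi w).
  exact: mulf_shuffle.
- move=> k t.
  exact: has_csum_summable (has_csum_Dmx_term phi_causal sigma2_gt0 le_pn convA (k:=k) (t:=t)).
- move=> le_2pn; split; first exact: rank_Dmx.
  move=> k t; case: ltnP => [tp|pt].
    by rewrite /D Dmx_left// /left_col /ar_phi0 tp.
  case: ltnP => [tnp|ntp].
    by rewrite mulr0 /D Dmx_middle//; have := ltn_ord t; lia.
  by rewrite /D Dmx_right//; [rewrite right_colE//; have := ltn_ord t; lia | have := ltn_ord t; lia].
- move=> lt_n2p k t; rewrite /D DmxE//; congr (_ * (_ + _)).
  case: leqP => [np|pn]; first by rewrite right_colE//; have := ltn_ord t; lia.
  by rewrite ar_phi0_gt ?mulr0//; have := ltn_ord t; lia.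
move=> p_gt0 le_2pn; have lt_pn : (p < n)%N by lia.
split; [exact: (Gamma_unit phi_causal) | exact: (Gamma_inv phi_causal)|].
move=> s t; rewrite /D (circulant_Dmx phi_causal)//.
pose F (m : int) a (j : nat) : R := a * ar_tilde p phi ((j%:Z + m) %% n%:Z)%Z.
have F0 m j : F m 0 j = 0 by exact: mul0r.
have nt : (0 < n - t)%N by rewrite subn_gt0.
have tn := ltn_ord t.
have := @sum_arpoly_tail R p phi _ (F s.+1%:Z) t.+1 isT (F0 _).
have := @sum_arpoly_tail R p phi _ (F (- s%:Z)) (n - t) nt (F0 _).
rewrite /F => -> ->.
congr (_%:C); case: (ltnP t p) => [tp|pt].
  have -> : (n - t <= p)%N = false by apply/negbTE; lia.
  rewrite addr0; congr (_ * _); by apply: eq_bigr => l _; rewrite addnC.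
rewrite add0r; case: ifPn => [ntp|ntp].
  have -> : (n - p + 1 <= t.+1)%N by lia.
  congr (_ * _); rewrite big_add1 /= (_ : (p - (n - t)).+1 = (p - (n - t.+1))%N); last by lia.
  apply: eq_bigr => l _; congr (phi _ * ar_tilde _ _ (_ %% _)%Z); lia.
have -> : (n - p + 1 <= t.+1)%N = false by apply/negbTE; lia.
by rewrite mulr0.
Qed.
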